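(* For $\beta=1,2$ and $x^{2\beta}<y<x^{2\beta+\beta^2}\log^{\frac52(\beta+1)}x$ (with $x$ large) one has \begin{align*} C_{2,\beta}(x,y)&=\frac{y\,x^{1+\beta}}{(1+\beta)\zeta(1+\beta)}-\frac12\,\frac{x^{2+2\beta}}{(1+\beta)^2\zeta^2(1+\beta)}+O\!\left(y^{-1}x^{2+4\beta}+x^{2\beta+1}(\log x+\log\log x)\right)\\ &\quad+O\!\left(x^{2\beta}y^{\frac13+\frac1{6\beta}}(\log^5 y)(\log\log y)(\log^4x+\log^4\log x)+y\,x^{\frac12+\beta}(\log^3x+\log^3\log x)\right). \end{align*} For every integer $\beta\ge 3$ and $y>x^{3\beta/2}$ one has \begin{align*} C_{2,\beta}(x,y)&=\frac{y\,x^{1+\beta}}{(1+\beta)\zeta(1+\beta)}+O\!\left(x^{2\beta}y^{\frac13+\frac1{6\beta}}(\log^5 y)(\log\log y)(\log^4x+\log^4\log x)\right)\\ &\quad+O\!\left(y\,x^{\frac12+\beta}(\log^3x+\log^3\log x)\right). \end{align*}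
   Context: For a positive integer $\beta$ and positive integers $q,n$, Cohen's generalized Ramanujan sum is \[ c_{q,\beta}(n):=\sum_{\substack{0\le h<q^{\beta}\\ (h,q^{\beta})_{\beta}=1}} e^{2\pi i n h/q^{\beta}}, \] where $(h,q^\beta)_\beta=1$ means that $h$ and $q^\beta$ have no common divisor which is a $\beta$-th power other than $1$. Define \[ C_{2,\beta}(x,y):=\sum_{n\le y}\Big(\sum_{q\le x}c_{q,\beta}(n)\Big)^2. \] $\zeta$ is the Riemann zeta function. *)

(* Defs.v *)
From HB Require Import structures.
From mathcomp Require Import all_boot all_order all_algebra.
From mathcomp Require Import complex.
From mathcomp Require Import all_classical all_reals all_analysis.

Set Implicit Arguments.
Unset Strict Implicit.
Unset Printing Implicit Defensive.

Import Order.TTheory GRing.Theory Num.Theory.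
Import numFieldNormedType.Exports.

Local Open Scope ring_scope.

(* The condition (a, b)_beta = 1. *)
Definition power_coprime (beta a b : nat) : Prop :=
  forall d : nat, (d ^ beta %| a)%N -> (d ^ beta %| b)%N -> (d ^ beta)%N = 1%N.

(* e^(i t) for real t, written out as cos t + i sin t. *)
Definition expi (R : realType) (t : R) : R[i] := Complex (cos t) (sin t).

(* c_{q,beta}(n), for q >= 1. *)
Definition cohen_sum (R : realType) (beta q n : nat) : R[i] :=
  \sum_(0 <= h < (q ^ beta)%N | `[< power_coprime beta h (q ^ beta)%N >])
    expi (2 * pi * n%:R * h%:R / (q ^ beta)%:R : R).

Definition C2 (R : realType) (beta : nat) (x y : R) : R[i] :=
  \sum_(1 <= n < (Num.truncn y).+1)
    (\sum_(1 <= q < (Num.truncn x).+1) cohen_sum R beta q n) ^+ 2.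

(* The Riemann zeta function on the half-line s > 1, where its Dirichlet series
   converges; outside of it the limit below is a junk value. *)
Definition zeta (R : realType) (s : R) : R := limn (series (riemannR s)).

(* f = O(g) on the pairs (x, y) in D with x large, uniformly in y. *)
Definition bigO_large (R : realType) (D : R -> R -> Prop) (f g : R -> R -> R)
    : Prop :=
  exists K x0 : R, forall x y : R, x0 <= x -> D x y ->
    `|f x y| <= K * `|g x y|.

(* Main.v *)
Require Import Defs.
From HB Require Import structures.
From mathcomp Require Import all_boot all_order all_algebra.
From mathcomp Require Import complex.
From mathcomp Require Import all_classical all_reals all_analysis.
From mathcomp Require Import zify ring lra.

Import Order.TTheory GRing.Theory Num.Theory.
Import numFieldNormedType.Exports.

Local Open Scope ring_scope.
Local Open Scope complex_scope.

(* Write M for the summatory function of the Moebius function mu, and put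
   w(d) = d^beta M(x/d).  Since c_{q,beta}(n) is the sum of mu(q/d) d^beta over
   the d | q with d^beta | n, summing over q <= x and squaring gives
     C_{2,beta}(x,y) = sum_{d,e <= x} w(d) w(e) floor(y / [d,e]^beta).
   With J = mu * id^beta, so that gcd^beta is a sum of J over common divisors,
   and sum_{k <= N} M(N/k) = 1, one gets
     sum_{d,e} w(d) w(e) / [d,e]^beta = sum_d w(d) = sum_{k <= x} J(k) =: P,
   and P = x^(1+beta) / ((1+beta) zeta(1+beta)) + O(x^beta log x).
   Dropping the fractional parts costs O(x^(2+2 beta)), which is admissible for
   beta >= 2.  For beta = 1 write floor(u) = u - 1/2 - psi(u): the 1/2 gives
   the second main term - P^2 / 2, and what remains is
   sum w(d) w(e) psi(y / [d,e]).  Resolving gcd(d,e) by Moebius inversion reduces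
   it to the sums G = sum_{a <= A} a psi(V/a), for which the hyperbola method
   gives G << A^3/V + A V^(1/2) log; summing over all parameters yields
   O(x^6/y + x^(5/2) y^(1/2) log^3), and x^2 < y makes the last term
   O(y x^(3/2) log^3). *)

(** * Divisor sums and lattice points under a hyperbola *)

Lemma sum_multiples (V : nmodType) (d N : nat) (G : nat -> V) : (0 < d)%N ->
  \sum_(1 <= n < N.+1 | (d %| n)%N) G n =
  \sum_(1 <= k < (N %/ d).+1) G (d * k)%N.
Proof.
move=> d0; elim: N => [|N IH]; first by rewrite div0n !big_geq.
rewrite big_mkcond big_nat_recr //= -big_mkcond IH divnS //.
case: ifPn => dN /=; last by rewrite add0n addr0.
rewrite add1n [RHS]big_nat_recr //=; congr (_ + G _).
have := divnK dN; rewrite divnS // dN add1n; lia.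
Qed.

(** Gives all divisor sums the same range, so that they can be exchanged with an outer sum; divisors
    of a positive [n] never exceed [n]. *)
Lemma sum_divisors_widen (V : nmodType) (n N : nat) (G : nat -> V) :
  (0 < n <= N)%N ->
  \sum_(1 <= d < n.+1 | (d %| n)%N) G d = \sum_(1 <= d < N.+1 | (d %| n)%N) G d.
Proof.
move=> /andP[n0 nN].
rewrite [RHS](big_cat_nat (n := n.+1)) //= [X in _ = _ + X]big_nat_cond.
rewrite [X in _ = _ + X]big1 ?addr0 // => d /andP[/andP[nd _] /dvdn_leq].
by move=> /(_ n0); lia.
Qed.

(** Writing [n = d * k], both sides run over the pairs with [d * k <= N]. *)
Lemma sum_divisor_pairs (V : nmodType) (N : nat) (F : nat -> nat -> V) :
  \sum_(1 <= n < N.+1) \sum_(1 <= d < n.+1 | (d %| n)%N) F d (n %/ d)%N =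
  \sum_(1 <= d < N.+1) \sum_(1 <= k < (N %/ d).+1) F d k.
Proof.
under eq_big_nat => n nN do rewrite (@sum_divisors_widen _ n N) // big_mkcond.
rewrite exchange_big /=; apply: eq_big_nat => d /andP[d0 _].
rewrite -big_mkcond sum_multiples //; apply: eq_bigr => k _.
by rewrite mulKn.
Qed.

(** The region [d * k <= N] is symmetric: once the inner range is widened to [N] with this condition
    as a filter, the two sums simply swap. *)
Lemma exchange_hyperbola (V : nmodType) (N : nat) (F : nat -> nat -> V) :
  \sum_(1 <= d < N.+1) \sum_(1 <= k < (N %/ d).+1) F d k =
  \sum_(1 <= k < N.+1) \sum_(1 <= d < (N %/ k).+1) F d k.
Proof.
have wide (H : nat -> V) d : (0 < d)%N -> \sum_(1 <= k < (N %/ d).+1) H k =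
    \sum_(1 <= k < N.+1) if (d * k <= N)%N then H k else 0.
  move=> d0; rewrite [RHS](big_cat_nat (n := (N %/ d).+1)) //=; last first.
    by rewrite ltnS leq_div.
  rewrite [X in _ = _ + X]big_nat_cond [X in _ = _ + X]big1 ?addr0.
    apply: eq_big_nat => k /andP[_]; rewrite ltnS leq_divRL // mulnC.
    by move->.
  move=> k; rewrite andbT => /andP[]; rewrite ltn_divLR // mulnC.
  by rewrite ltnNge => /negPf->.
transitivity (\sum_(1 <= d < N.+1) \sum_(1 <= k < N.+1)
    if (d * k <= N)%N then F d k else 0).
  by apply: eq_big_nat => d /andP[d0 _]; rewrite wide.
rewrite exchange_big /=; apply: eq_big_nat => k /andP[k0 _].
by rewrite wide //; apply: eq_bigr => d _; rewrite mulnC.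
Qed.

(** * The Moebius function and Moebius inversion *)

Definition mobius (n : nat) : int :=
  if all (fun p => logn p n <= 1)%N (primes n) then (-1) ^+ size (primes n)
  else 0.

Lemma norm_mobius_le1 (R : numDomainType) (n : nat) :
  `|(mobius n)%:~R : R| <= 1.
Proof.
rewrite /mobius; case: ifP => _; last by rewrite normr0 ler01.
by rewrite rmorph_sign normr_sign.
Qed.

(** The only form of multiplicativity required: it drives the cancellation in [sum_mobius]. *)
Lemma mobius_primeM (p k : nat) : prime p -> (0 < k)%N ->
  mobius (p * k) = if (p %| k)%N then 0 else - mobius k.
Proof.
move=> pp k0; have p0 := prime_gt0 pp; rewrite /mobius.
have logpk : logn p (p * k) = (logn p k).+1.
  by rewrite lognM // logn_prime // eqxx.
have [pk|pk] := boolP (p %| k)%N.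
  suff -> : all (fun q => logn q (p * k) <= 1)%N (primes (p * k)) = false by [].
  apply/negP => /allP /(_ p); rewrite logpk ltnS leqn0.
  rewrite mem_primes pp muln_gt0 p0 k0 dvdn_mulr // => /(_ isT).
  by rewrite -leqn0 leqNgt logn_gt0 mem_primes pp k0 pk.
have eqp : perm_eq (primes (p * k)) (p :: primes k).
  apply: uniq_perm; rewrite ?primes_uniq //=.
    by rewrite primes_uniq mem_primes (negPf pk) !andbF.
  by move=> q; rewrite primesM // primes_prime // !inE.
rewrite (perm_all _ eqp) (perm_size eqp) /= exprS mulN1r.
have -> : (logn p (p * k) <= 1)%N.
  by rewrite logpk ltnS leqNgt logn_gt0 mem_primes (negPf pk) !andbF.
have -> : all (fun q => logn q (p * k) <= 1)%N (primes k) =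
          all (fun q => logn q k <= 1)%N (primes k).
  apply: eq_in_all => q; rewrite mem_primes => /and3P[pq _ qk].
  rewrite lognM // logn_prime //; case: eqP => [e|]; last by rewrite add0n.
  by rewrite -e qk in pk.
by rewrite /=; case: ifP; rewrite ?oppr0.
Qed.

(** For [n > 1] take a prime [p] dividing [n]. A divisor [p * k] contributes [- mobius k] if [p]
    does not divide [k] and nothing otherwise, which cancels the divisors prime to [p]. *)
Lemma sum_mobius (n : nat) : (0 < n)%N ->
  \sum_(1 <= d < n.+1 | (d %| n)%N) mobius d = (n == 1)%:R.
Proof.
move=> n0; have [->|n1] := eqVneq n 1%N.
  by rewrite big_mkcond big_nat1 /=.
have n2 : (1 < n)%N by lia.
set p := pdiv n; have pp : prime p := pdiv_prime n2.
have pn : (p %| n)%N := pdiv_dvd n; have p0 := prime_gt0 pp.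
rewrite (bigID (fun d => p %| d)%N) /=.
rewrite (eq_bigl (fun d => (p %| d) && (d %| n))%N); last by move=> d; rewrite andbC.
rewrite big_mkcondr sum_multiples //.
have -> : \sum_(1 <= k < (n %/ p).+1)
    (if (p * k %| n)%N then mobius (p * k) else 0) =
    - \sum_(1 <= k < (n %/ p).+1 | (k %| n %/ p)%N && ~~ (p %| k)%N) mobius k.
  rewrite -sumrN [RHS]big_mkcond; apply: eq_big_nat => k /andP[k0 _].
  rewrite mobius_primeM // dvdn_divRL // mulnC.
  by case: ifP => //= _; case: ifP.
rewrite addrC; apply/eqP; rewrite subr_eq0; apply/eqP.
have np0 : (0 < n %/ p)%N by rewrite divn_gt0 // dvdn_leq.
rewrite [LHS]big_mkcondr [RHS]big_mkcondr.
rewrite [RHS](@sum_divisors_widen _ _ n) ?np0 ?leq_div //.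
rewrite big_mkcond [RHS]big_mkcond; apply: eq_bigr => k _.
case: (boolP (p %| k)%N) => pk /=; first by rewrite !if_same.
(* For [k] prime to [p], dividing [n %/ p] is the same as dividing [n]. *)
rewrite dvdn_divRL // mulnC Gauss_dvd ?pn //.
by rewrite prime_coprime.
Qed.

(** Used to replace a function of a gcd by a sum over common divisors. Grouping the pairs with
    [e * k] dividing [n] by [k] leaves the sum of [mobius] over the divisors of [n %/ k], which is
    zero unless [k = n]. *)
Lemma mobius_inversion (R : comPzRingType) (h : nat -> R) (n : nat) :
  (0 < n)%N ->
  \sum_(1 <= k < n.+1 | (k %| n)%N)
    \sum_(1 <= e < k.+1 | (e %| k)%N) (mobius e)%:~R * h (k %/ e)%N = h n.
Proof.
move=> n0; pose F e k := if (e * k %| n)%N then (mobius e)%:~R * h k else 0.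
transitivity (\sum_(1 <= k < n.+1) \sum_(1 <= e < k.+1 | (e %| k)%N)
    F e (k %/ e)%N).
  rewrite big_mkcond; apply: eq_bigr => k _; rewrite /F.
  case: ifP => kn.
    by apply: eq_bigr => e ek; rewrite mulnC divnK // kn.
  by rewrite big1 // => e ek; rewrite mulnC divnK // kn.
rewrite sum_divisor_pairs exchange_hyperbola.
transitivity (\sum_(1 <= k < n.+1) if k == n then h n else 0); last first.
  by rewrite big_nat_recr //= eqxx big_nat big1 ?add0r // => k /andP[_ /ltn_eqF->].
apply: eq_big_nat => k /andP[k0 kn]; rewrite ltnS in kn; rewrite /F.
have [kn'|kn'] := boolP (k %| n)%N; last first.
  case: eqP => [e|_]; first by rewrite e dvdnn in kn'.
  apply: big1 => e _; case: ifP => // ekn.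
  by rewrite (dvdn_trans (dvdn_mull e (dvdnn k)) ekn) in kn'.
transitivity ((\sum_(1 <= e < (n %/ k).+1 | (e %| n %/ k)%N) mobius e)%:~R * h k).
  rewrite rmorph_sum big_distrl /= [RHS]big_mkcond; apply: eq_bigr => e _.
  by rewrite dvdn_divRL.
rewrite sum_mobius ?divn_gt0 // eq_sym eqn_div // mul1n.
by case: eqP => [->|]; rewrite ?mul1r ?mul0r.
Qed.

(** * Complete exponential sums *)

Lemma expiD (R : realType) (s t : R) : expi (s + t) = expi s * expi t.
Proof.
by rewrite /expi cosD sinD; simpc; rewrite [sin s * _ + _]addrC.
Qed.

Lemma expi0 (R : realType) : expi (0 : R) = 1.
Proof. by rewrite /expi cos0 sin0. Qed.

Lemma expi_mulrn (R : realType) (t : R) (n : nat) :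
  expi (t * n%:R) = expi t ^+ n.
Proof.
elim: n => [|n IH]; first by rewrite mulr0 expi0.
by rewrite -natr1 mulrDr mulr1 expiD IH exprSr.
Qed.

Lemma expi2pi (R : realType) : expi (2 * pi : R) = 1.
Proof. by rewrite /expi mulr_natl cos2pi sin2pi. Qed.

(** If [cos t = 1] then [sin (t / 2)] vanishes by the half-angle formula, whereas [sin] is positive
    strictly between [0] and [pi]. *)
Lemma expi_eq1 (R : realType) (t : R) : 0 <= t < 2 * pi ->
  (expi t == 1) = (t == 0).
Proof.
move=> /andP[t0 t2]; apply/eqP/eqP => [|->]; last exact: expi0.
rewrite /expi => -[ct st]; apply/eqP; rewrite eq_le t0 andbT leNgt.
apply/negP => tgt0.
have s0 : 0 < sin (t / 2) by apply: sin_gt0_pi; lra.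
have := sin2cos2 (t / 2); have := cos_mulr2n (t / 2).
have -> : t / 2 *+ 2 = t by rewrite -mulr_natr divfK ?pnatr_eq0.
rewrite ct => c1.
have := exprn_gt0 2 s0; lra.
Qed.

Lemma expi_root_eq1 (R : realType) (N n : nat) : (0 < N)%N ->
  (expi (2 * pi * n%:R / N%:R : R) == 1) = (N %| n)%N.
Proof.
move=> N0; have N0' : (0 : R) < N%:R by rewrite ltr0n.
rewrite {1}(divn_eq n N).
have -> : 2 * pi * (n %/ N * N + n %% N)%:R / N%:R =
   2 * pi * (n %/ N)%:R + 2 * pi * (n %% N)%:R / N%:R :> R.
  by rewrite natrD natrM; field; rewrite gt_eqF.
rewrite expiD expi_mulrn expi2pi expr1n mul1r expi_eq1.
  have p0 : (pi : R) != 0 by rewrite gt_eqF // pi_gt0.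
  by rewrite !mulf_eq0 invr_eq0 !pnatr_eq0 (negPf p0) (eqn0Ngt N) N0 /= orbF.
have pp := pi_gt0 R; have tp : 0 < 2 * pi :> R by lra.
apply/andP; split; first by rewrite !mulr_ge0 ?invr_ge0 // ltW.
by rewrite -mulrA gtr_pMr // ltr_pdivrMr // mul1r ltr_nat ltn_pmod.
Qed.

(** A geometric sum with ratio [z], an [N]-th root of unity: multiplied by [z - 1] it becomes
    [z ^ N - 1 = 0], so it vanishes unless [z = 1]. *)
Lemma sum_expi (R : realType) (N n : nat) : (0 < N)%N ->
  \sum_(0 <= h < N) expi (2 * pi * n%:R * h%:R / N%:R : R) =
  if (N %| n)%N then N%:R else 0.
Proof.
move=> N0; have N0' : (N%:R : R) != 0 by rewrite pnatr_eq0 -lt0n.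
set z := expi (2 * pi * n%:R / N%:R : R).
rewrite (eq_bigr (fun h => z ^+ h)); last first.
  by move=> h _; rewrite -expi_mulrn; congr expi; field.
have [/eqP z1|z1] := boolP (z == 1).
  rewrite -(@expi_root_eq1 R) // -/z z1 eqxx.
  under eq_bigr => h _ do rewrite expr1n.
  by rewrite big_const_nat subn0 iter_addr_0.
rewrite -(@expi_root_eq1 R) // -/z (negPf z1).
apply: (mulfI (x := z - 1)); first by rewrite subr_eq0.
rewrite mulr0 big_mkord -subrX1 -expi_mulrn divfK // expi_mulrn expi2pi.
by rewrite expr1n subrr.
Qed.

(** * Common power divisors and Cohen's sum as a divisor sum *)

(** With [g] the gcd, [c %/ g] and [d %/ g] are coprime, hence so are their [b]-th powers; both
    divide [h %/ g ^ b], so their product does too. *)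
Lemma lcmn_exp_dvd (b c d h : nat) :
  (c ^ b %| h -> d ^ b %| h -> lcmn c d ^ b %| h)%N.
Proof.
have [->|c0] := posnP c; first by rewrite lcm0n.
have g0 : (0 < gcdn c d)%N by rewrite gcdn_gt0 c0.
move=> ch dh; set g := gcdn c d in g0 *.
have cE : (c = c %/ g * g)%N by rewrite divnK // dvdn_gcdl.
have dE : (d = d %/ g * g)%N by rewrite divnK // dvdn_gcdr.
have cop : coprime (c %/ g) (d %/ g).
  by rewrite /coprime -(eqn_pmul2r g0) muln_gcdl -cE -dE mul1n.
have -> : lcmn c d = (c %/ g * (d %/ g) * g)%N.
  by rewrite /lcmn -/g -mulnA -dE mulnC -muln_divA ?dvdn_gcdl // mulnC.
have gh : (g ^ b %| h)%N.
  by apply: dvdn_trans ch; apply: dvdn_exp2r; apply: dvdn_gcdl.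
rewrite -(divnK gh) !expnMn dvdn_pmul2r ?expn_gt0 ?g0 //.
rewrite Gauss_dvd; last first.
  by case: b {ch dh gh} => [//|b]; rewrite coprime_pexpl // coprime_pexpr.
by rewrite !dvdn_divRL // -!expnMn -cE -dE ch.
Qed.

(** [G ^ b] is the generalized gcd of [h] and [q ^ b]. It is built as the lcm of all admissible [d],
    which is again admissible by [lcmn_exp_dvd]. *)
Lemma power_gcd_exists (b q h : nat) : (0 < q)%N ->
  exists2 G, (0 < G)%N & forall d, (d %| q)%N && (d ^ b %| h)%N = (d %| G)%N.
Proof.
move=> q0; pose P G := (G %| q)%N && (G ^ b %| h)%N.
pose G := \big[lcmn/1%N]_(d <- divisors q | (d ^ b %| h)%N) d.
have PG : P G.
  rewrite /G big_seq_cond; apply: (big_ind P).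
  - by rewrite /P dvd1n exp1n dvd1n.
  - move=> c d /andP[c1 c2] /andP[d1 d2]; rewrite /P dvdn_lcm c1 d1.
    exact: lcmn_exp_dvd.
  - by move=> d; rewrite -dvdn_divisors.
have [Gq Gh] := andP PG.
exists G => [|d]; first by apply: dvdn_gt0 Gq.
apply/andP/idP => [[dq dh]|dG].
  rewrite /G big_mkcond (bigD1_seq d) ?divisors_uniq -?dvdn_divisors //= dh.
  exact: dvdn_lcml.
split; first exact: dvdn_trans Gq.
exact: dvdn_trans (dvdn_exp2r b dG) Gh.
Qed.

(** The sum runs over the divisors of [G] from [power_gcd_exists], so it is [1] or [0] according to
    whether [G = 1]. *)
Lemma power_coprime_mobius (b q h : nat) : (0 < b)%N -> (0 < q)%N ->
  (`[< power_coprime b h (q ^ b)%N >])%:R =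
  \sum_(1 <= d < q.+1 | (d %| q)%N && (d ^ b %| h)%N) mobius d.
Proof.
move=> b0 q0; have [G G0 GP] := power_gcd_exists b q h q0.
have /andP[Gq Gh] : (G %| q)%N && (G ^ b %| h)%N by rewrite GP.
rewrite (eq_bigl _ _ GP) -(@sum_divisors_widen _ G q); last first.
  by rewrite G0 dvdn_leq.
rewrite sum_mobius //; congr (_%:R); congr nat_of_bool.
apply/asboolP/eqP => [/(_ G Gh)|G1 d dh].
  rewrite dvdn_pexp2r // => /(_ Gq) /eqP; rewrite -(exp1n b) eqn_exp2r //.
  by move/eqP.
rewrite dvdn_pexp2r // => dq; have := GP d; rewrite dh dq G1 dvdn1.
by move=> /esym/eqP->; rewrite exp1n.
Qed.

Lemma sum_multiples0 (V : nmodType) (d M : nat) (G : nat -> V) : (0 < d)%N ->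
  \sum_(0 <= h < d * M | (d %| h)%N) G h = \sum_(0 <= k < M) G (d * k)%N.
Proof.
move=> d0; case: M => [|M]; first by rewrite muln0 !big_geq.
rewrite big_mkcond big_ltn ?muln_gt0 ?d0 // dvdn0 -big_mkcond.
rewrite [RHS]big_ltn // muln0; congr (_ + _).
(* The end point is shifted to [d * M + d.-1], whose quotient by [d] is still [M], to fit the range
   of [sum_multiples]. *)
have -> : (d * M.+1 = (d * M + d.-1).+1)%N by rewrite mulnS; lia.
by rewrite sum_multiples // mulnC divnMDl // divn_small ?addn0 // prednK.
Qed.

(** Detect the coprimality condition by [power_coprime_mobius] and put [h = d ^ b * k]: the sum over
    [k] is then a complete exponential sum modulo [(q %/ d) ^ b]. *)
Lemma cohen_sum_mobius (R : realType) (b q n : nat) : (0 < b)%N -> (0 < q)%N ->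
  cohen_sum R b q n = (\sum_(1 <= d < q.+1 | (d %| q)%N)
    (mobius d)%:~R * if ((q %/ d) ^ b %| n)%N then ((q %/ d) ^ b)%:R else 0)%:C.
Proof.
move=> b0 q0; rewrite /cohen_sum big_mkcond /=.
rewrite (eq_bigr (fun h => \sum_(1 <= d < q.+1 | (d %| q)%N)
   if (d ^ b %| h)%N then
     (mobius d)%:~R * expi (2 * pi * n%:R * h%:R / (q ^ b)%:R : R) else 0));
  last first.
  move=> h _; rewrite -big_mkcondr /= -big_distrl /=.
  rewrite -(rmorph_sum (intr : int -> R[i])) /= -power_coprime_mobius //.
  by case: `[< _ >]; rewrite ?mul1r ?mul0r.
rewrite exchange_big /= rmorph_sum big_seq_cond [RHS]big_seq_cond.
apply: eq_bigr => d /andP[]; rewrite mem_index_iota => /andP[d0 _] dq.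
have qE : (q ^ b = d ^ b * (q %/ d) ^ b)%N.
  by rewrite -expnMn mulnC divnK.
have qd0 : (0 < q %/ d)%N by rewrite divn_gt0 // dvdn_leq.
rewrite {1}qE -big_mkcond sum_multiples0 ?expn_gt0 ?d0 // -big_distrr /=.
rewrite rmorphM rmorph_int; congr (_ * _).
rewrite (eq_bigr (fun k => expi (2 * pi * n%:R * k%:R / ((q %/ d) ^ b)%:R : R))).
  rewrite sum_expi ?expn_gt0 ?qd0 //.
  by case: ifP; rewrite ?rmorph_nat ?rmorph0.
move=> k _; congr expi; rewrite qE !natrM.
have ? : ((d ^ b)%:R : R) != 0 by rewrite pnatr_eq0 -lt0n expn_gt0 d0.
have ? : (((q %/ d) ^ b)%:R : R) != 0 by rewrite pnatr_eq0 -lt0n expn_gt0 qd0.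
by field; apply/andP.
Qed.

(** * The second moment as a quadratic form in the weights *)

Definition mertens (R : pzRingType) (N : nat) : R :=
  \sum_(1 <= m < N.+1) (mobius m)%:~R.

Definition weight (R : pzRingType) (b X d : nat) : R :=
  (d ^ b)%:R * mertens R (X %/ d).

(** Jordan's totient of order [b]; Euler's totient for [b = 1]. *)
Definition jordan (R : pzRingType) (b k : nat) : R :=
  \sum_(1 <= e < k.+1 | (e %| k)%N) (mobius e)%:~R * ((k %/ e) ^ b)%:R.

(** Grouping the pairs [d], [m] by their product [n] gives the sum of [mobius] over the divisors of
    [n], which survives only at [n = 1]. *)
Lemma sum_mertens (R : pzRingType) (N : nat) : (0 < N)%N ->
  \sum_(1 <= d < N.+1) mertens R (N %/ d) = 1.
Proof.
move=> N0; rewrite /mertens exchange_hyperbola.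
rewrite -(sum_divisor_pairs _ _ (fun d _ => (mobius d)%:~R)).
rewrite (eq_big_nat _ _ (F2 := fun n => (n == 1%N)%:R)); last first.
  by move=> n /andP[n0 _]; rewrite -rmorph_sum sum_mobius // rmorph_nat.
rewrite big_ltn // eqxx big_nat big1 ?addr0 // => n /andP[n1 _].
by rewrite gtn_eqF.
Qed.

(** After the hyperbola exchange the cofactor [q %/ d] is outermost, and the inner sum of [mobius]
    is a value of [mertens]. *)
Lemma sum_cohen_sum (R : realType) (b X n : nat) : (0 < b)%N ->
  \sum_(1 <= q < X.+1) cohen_sum R b q n =
  (\sum_(1 <= d < X.+1 | (d ^ b %| n)%N) weight R b X d)%:C.
Proof.
move=> b0; pose F d k : R :=
  (mobius d)%:~R * if (k ^ b %| n)%N then (k ^ b)%:R else 0.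
rewrite (eq_big_nat _ _ (F2 := fun q =>
  (\sum_(1 <= d < q.+1 | (d %| q)%N) F d (q %/ d)%N)%:C)); last first.
  by move=> q /andP[q0 _]; rewrite cohen_sum_mobius.
rewrite -rmorph_sum /= sum_divisor_pairs exchange_hyperbola; congr (_%:C).
rewrite [RHS]big_mkcond; apply: eq_bigr => d _.
rewrite /F -big_distrl /= -/(mertens R _) /weight mulrC.
by case: ifP; rewrite ?mul0r.
Qed.

Lemma lcmn_exp (b d e : nat) : lcmn (d ^ b) (e ^ b) = (lcmn d e ^ b)%N.
Proof.
apply/eqP; rewrite eqn_dvd dvdn_lcm !dvdn_exp2r ?dvdn_lcml ?dvdn_lcmr //=.
by rewrite lcmn_exp_dvd // ?dvdn_lcml ?dvdn_lcmr.
Qed.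

Lemma count_multiples (R : pzRingType) (a Y : nat) : (0 < a)%N ->
  \sum_(1 <= n < Y.+1 | (a %| n)%N) 1 = (Y %/ a)%:R :> R.
Proof.
move=> a0; rewrite sum_multiples // big_const_nat subSS subn0.
by rewrite iter_addr_0.
Qed.

Definition C2_real (R : realType) (b : nat) (x y : R) : R :=
  \sum_(1 <= d < (Num.truncn x).+1) \sum_(1 <= e < (Num.truncn x).+1)
    weight R b (Num.truncn x) d * weight R b (Num.truncn x) e *
    (Num.truncn y %/ lcmn d e ^ b)%:R.

(** Expand the square and count the [n] divisible by both [d ^ b] and [e ^ b]. The value turns out
    to be real, so all later estimates take place in [R]. *)
Lemma C2E (R : realType) (b : nat) (x y : R) : (0 < b)%N ->
  C2 b x y = (C2_real R b x y)%:C.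
Proof.
move=> b0; rewrite /C2 /C2_real; set X := Num.truncn x; set Y := Num.truncn y.
under eq_bigr => n _ do rewrite sum_cohen_sum // -rmorphXn /=.
rewrite -rmorph_sum /=; congr (_%:C).
pose w n d : R := if (d ^ b %| n)%N then weight R b X d else 0.
transitivity (\sum_(1 <= n < Y.+1) \sum_(1 <= d < X.+1) \sum_(1 <= e < X.+1)
    w n d * w n e).
  apply: eq_bigr => n _; rewrite expr2 big_mkcond big_distrl /=.
  by apply: eq_bigr => d _; rewrite big_distrr.
rewrite exchange_big; apply: eq_big_nat => d /andP[d0 _].
rewrite exchange_big; apply: eq_big_nat => e /andP[e0 _] /=.
rewrite -count_multiples ?expn_gt0 ?lcmn_gt0 ?d0 ?e0 //.
rewrite -lcmn_exp big_distrr /= [RHS]big_mkcond; apply: eq_bigr => n _.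
by rewrite dvdn_lcm /w; do 2!case: ifP; rewrite ?mulr0 ?mul0r ?mulr1.
Qed.

Lemma sum_weight (R : comPzRingType) (b X : nat) :
  \sum_(1 <= d < X.+1) weight R b X d = \sum_(1 <= k < X.+1) jordan R b k.
Proof.
rewrite (sum_divisor_pairs _ _ (fun e k => (mobius e)%:~R * (k ^ b)%:R)).
rewrite exchange_hyperbola; apply: eq_bigr => d _.
rewrite /weight /mertens big_distrr /=; apply: eq_bigr => m _.
exact: mulrC.
Qed.

(** Since [d * e] is lcm times gcd, the summand is [gcdn d e ^ b] times two values of [mertens].
    Writing that power as a sum of [jordan] over the common divisors [k] makes the sums over [d] and
    [e] factor. *)
Lemma sum_weight_lcm (R : numFieldType) (b X : nat) :
  \sum_(1 <= d < X.+1) \sum_(1 <= e < X.+1)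
    weight R b X d * weight R b X e / (lcmn d e ^ b)%:R =
  \sum_(1 <= k < X.+1) jordan R b k.
Proof.
pose u k d : R := if (k %| d)%N then mertens R (X %/ d) else 0.
transitivity (\sum_(1 <= d < X.+1) \sum_(1 <= e < X.+1) \sum_(1 <= k < X.+1)
    jordan R b k * u k d * u k e).
  apply: eq_big_nat => d /andP[d0 dX]; apply: eq_big_nat => e /andP[e0 eX].
  have g0 : (0 < gcdn d e)%N by rewrite gcdn_gt0 d0.
  have gX : (gcdn d e <= X)%N.
    by rewrite (leq_trans (dvdn_leq d0 (dvdn_gcdl d e))).
  transitivity ((gcdn d e ^ b)%:R * mertens R (X %/ d) * mertens R (X %/ e)).
    have l0 : ((lcmn d e ^ b)%:R : R) != 0.
      by rewrite pnatr_eq0 -lt0n expn_gt0 lcmn_gt0 d0 e0.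
    apply: (mulIf l0); rewrite divfK // /weight mulrACA -natrM -expnMn.
    by rewrite -muln_lcm_gcd expnMn natrM; ring.
  rewrite -(@mobius_inversion _ (fun n => (n ^ b)%:R) _ g0).
  rewrite (@sum_divisors_widen _ _ X) ?g0 // !big_distrl /= big_mkcond /=.
  apply: eq_bigr => k _; rewrite dvdn_gcd /u.
  by case: (k %| d)%N; case: (k %| e)%N; rewrite /= ?mulr0 ?mul0r.
under eq_bigr => d _ do rewrite exchange_big.
rewrite exchange_big; apply: eq_big_nat => k /andP[k0 kX] /=.
(* Only multiples of [k] contribute, and they give [sum_mertens] at [X %/ k], which is positive
   because [k <= X]. *)
have u1 : \sum_(1 <= d < X.+1) u k d = 1.
  rewrite -big_mkcond sum_multiples //.
  under eq_bigr => j _ do rewrite divnMA.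
  by rewrite sum_mertens // divn_gt0.
under eq_bigr => d _ do rewrite -big_distrr /= u1 mulr1.
by rewrite -big_distrr /= u1 mulr1.
Qed.

(** * Harmonic sums, tails of series and sums of powers *)

Definition harmonic_sum (R : numFieldType) (N : nat) : R :=
  \sum_(1 <= m < N.+1) m%:R^-1.

Lemma harmonic_sum_ge0 (R : numFieldType) (N : nat) : 0 <= harmonic_sum R N.
Proof. by rewrite sumr_ge0 // => m _; rewrite invr_ge0. Qed.

Lemma le_harmonic_sum (R : numFieldType) (M N : nat) : (M <= N)%N ->
  harmonic_sum R M <= harmonic_sum R N.
Proof.
move=> MN; rewrite /harmonic_sum [leRHS](big_cat_nat (n := M.+1)) //=.
by rewrite lerDl sumr_ge0 // => m _; rewrite invr_ge0.
Qed.

(** The induction step is [ln (1 + t) <= t] at [t = - 1 / (N + 2)]. *)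
Lemma harmonic_sum_le_ln (R : realType) (N : nat) : (0 < N)%N ->
  harmonic_sum R N <= 1 + ln N%:R.
Proof.
elim: N => // -[_ _|N IH _]; first by rewrite /harmonic_sum big_nat1 ln1; lra.
rewrite /harmonic_sum big_nat_recr //=.
have N0 : (0 : R) < N.+1%:R by rewrite ltr0n.
have N2 : (0 : R) < N.+2%:R by rewrite ltr0n.
have : ln (1 + - N.+2%:R^-1) <= - N.+2%:R^-1 :> R.
  apply: le_ln1Dx; rewrite ltrN2 invf_lt1 //.
  by rewrite ltr1n.
have -> : 1 + - N.+2%:R^-1 = N.+1%:R / N.+2%:R :> R.
  by rewrite -[N.+1%:R](addrK 1) natr1 mulrBl mul1r divff ?gt_eqF.
rewrite ln_div ?posrE // => h.
move: h (IH isT); rewrite /harmonic_sum.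
move: (ln _) (ln _) (N.+2%:R^-1) (\sum_(1 <= i < N.+2) _) => a c v s; lra.
Qed.

Lemma harmonic_sum_truncn (R : realType) (x : R) : 1 <= x ->
  harmonic_sum R (Num.truncn x) <= 1 + ln x.
Proof.
move=> x1; have X0 : (0 < Num.truncn x)%N by rewrite truncn_gt0.
apply: le_trans (harmonic_sum_le_ln _ _ X0) _; rewrite lerD2l ler_ln ?posrE.
- by rewrite truncn_le; lra.
- by rewrite ltr0n.
- by lra.
Qed.

(** Telescoping, as [1 / k ^ 2 <= 1 / (k - 1) - 1 / k]. *)
Lemma sum_inv_sqr_le (R : numFieldType) (N M : nat) : (0 < N)%N ->
  \sum_(N.+1 <= k < M) (k%:R ^+ 2)^-1 <= N%:R^-1 :> R.
Proof.
move=> N0; have [MN|NM] := leqP M N.+1.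
  by rewrite big_geq // invr_ge0.
apply: (@le_trans _ _ (\sum_(N.+1 <= k < M) (- k%:R^-1 - (- k.-1%:R^-1)))).
  apply: ler_sum_nat => k /andP[Nk _].
  have k0 : (0 : R) < k.-1%:R by rewrite ltr0n; lia.
  have -> : (k%:R : R) = k.-1%:R + 1 by rewrite natr1 prednK //; lia.
  set u : R := k.-1%:R in k0 *.
  have u1 : 0 < u + 1 by rewrite addr_gt0.
  rewrite -subr_ge0.
  have -> : - (u + 1)^-1 - - u^-1 - ((u + 1) ^+ 2)^-1 = (u * (u + 1) ^+ 2)^-1.
    by field; rewrite !gt_eqF.
  by rewrite invr_ge0 mulr_ge0 ?exprn_ge0 // ltW.
have -> : \sum_(N.+1 <= k < M) (- k%:R^-1 - (- k.-1%:R^-1)) =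
    \sum_(N <= k < M.-1) (- k.+1%:R^-1 - (- k%:R^-1)) :> R.
  by rewrite big_add1.
rewrite (telescope_sumr (fun k => - k%:R^-1)); last by lia.
by rewrite opprK gerDr oppr_le0 invr_ge0.
Qed.

(** Bound [b - 1] of the factors by their value at [N + 1], and split off the first term of the
    remaining sum of inverse squares. That keeps [N = 0] allowed, where the bound is [2] for the
    whole series. *)
Lemma sum_inv_exp_tail (R : numFieldType) (b N M : nat) : (0 < b)%N ->
  \sum_(N.+1 <= k < M) (k%:R ^+ b.+1)^-1 <= 2 / N.+1%:R ^+ b :> R.
Proof.
move=> b0; have N1 : (0 : R) < N.+1%:R by rewrite ltr0n.
have [MN|NM] := leqP M N.+1.
  by rewrite big_geq // divr_ge0 // exprn_ge0.
apply: (@le_trans _ _ ((N.+1%:R ^+ b.-1)^-1 * \sum_(N.+1 <= k < M) (k%:R ^+ 2)^-1)).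
  rewrite big_distrr /=; apply: ler_sum_nat => k /andP[Nk _].
  have k0 : (0 : R) < k%:R by rewrite ltr0n; lia.
  have -> : b.+1 = (b.-1 + 2)%N by lia.
  rewrite exprD invfM ler_wpM2r ?invr_ge0 ?exprn_ge0 //.
  rewrite lef_pV2 ?posrE ?exprn_gt0 //.
  by rewrite lerXn2r ?nnegrE ?ler0n // ler_nat.
have -> : 2 / N.+1%:R ^+ b = (N.+1%:R ^+ b.-1)^-1 * (2 / N.+1%:R) :> R.
  by rewrite -{1}(prednK b0) exprSr invfM mulrCA.
rewrite ler_wpM2l ?invr_ge0 ?exprn_ge0 // big_ltn //.
rewrite mulr_natl mulr2n lerD ?sum_inv_sqr_le //.
by rewrite lef_pV2 ?posrE ?exprn_gt0 // ler_eXnr // ler1n.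
Qed.

(** The mean value theorem for a power, proved algebraically. *)
Lemma subrX_bounds (R : realFieldType) (n : nat) (x y : R) : 0 <= y -> y <= x ->
  n.+1%:R * (x - y) * y ^+ n <= x ^+ n.+1 - y ^+ n.+1 <=
  n.+1%:R * (x - y) * x ^+ n.
Proof.
move=> y0 yx; have x0 := le_trans y0 yx.
elim: n => [|n /andP[IH1 IH2]]; first by rewrite !expr0 !expr1; lra.
have E : x ^+ n.+2 - y ^+ n.+2 =
    x * (x ^+ n.+1 - y ^+ n.+1) + (x - y) * y ^+ n.+1.
  by rewrite 2!(exprS _ n.+1); ring.
have yn : y ^+ n.+1 <= x ^+ n.+1 by rewrite lerXn2r ?nnegrE.
have yn0 : 0 <= y ^+ n.+1 by rewrite exprn_ge0.
rewrite E -[n.+2%:R]natr1; apply/andP; split.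
  have h1 := ler_wpM2l x0 IH1.
  have h2 : y * (n.+1%:R * (x - y) * y ^+ n) <= x * (n.+1%:R * (x - y) * y ^+ n).
    by rewrite ler_wpM2r // mulr_ge0 ?exprn_ge0 // mulr_ge0 ?subr_ge0.
  by rewrite (exprS y n) in h1 *; lra.
have h1 := ler_wpM2l x0 IH2.
have h2 : (x - y) * y ^+ n.+1 <= (x - y) * x ^+ n.+1.
  by rewrite ler_wpM2l ?subr_ge0.
by rewrite (exprS x n) in h1 h2 *; lra.
Qed.

Lemma sum_exp_bounds (R : realFieldType) (b N : nat) :
  (N%:R : R) ^+ b.+1 <= b.+1%:R * \sum_(1 <= d < N.+1) d%:R ^+ b <=
  (N.+1%:R : R) ^+ b.+1.
Proof.
elim: N => [|N /andP[IH1 IH2]].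
  by rewrite big_geq // mulr0 expr0n /= lexx expr1n ler01.
rewrite big_nat_recr //= mulrDr.
have [] : [/\ (0 : R) <= N%:R, (N%:R : R) <= N.+1%:R, (0 : R) <= N.+1%:R &
  (N.+1%:R : R) <= N.+2%:R] by split; rewrite ?ler_nat.
move=> h0 h1 h2 h3.
have /andP[_ k2] := subrX_bounds R b _ _ h0 h1.
have /andP[k1 _] := subrX_bounds R b _ _ h2 h3.
rewrite -[N.+2%:R]natr1 -[N.+1%:R]natr1 in k1 k2 IH1 IH2 *.
move: k1 k2.
have -> : N%:R + 1 + 1 - (N%:R + 1) = 1 :> R by ring.
have -> : N%:R + 1 - N%:R = 1 :> R by ring.
rewrite !mulr1 => k1 k2.
by apply/andP; split; lra.
Qed.

(** Both [u ^ b.+1] and [b.+1] times the sum lie between [N ^ b.+1] and [(N + 1) ^ b.+1]; the width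
    of this interval is controlled by [subrX_bounds] and [N + 1 <= 2 * u]. *)
Lemma sum_exp_asymp (R : realFieldType) (b N : nat) (u : R) :
  (0 < N)%N -> N%:R <= u < N.+1%:R ->
  `|\sum_(1 <= d < N.+1) d%:R ^+ b - u ^+ b.+1 / b.+1%:R| <= (2 * u) ^+ b.
Proof.
move=> N0 /andP[Nu uN].
have N1 : (1 : R) <= N%:R by rewrite ler1n.
have b0 : (0 : R) < b.+1%:R by rewrite ltr0n.
have /andP[s1 s2] := sum_exp_bounds R b N.
have u1 : N%:R ^+ b.+1 <= u ^+ b.+1.
  by rewrite lerXn2r ?nnegrE //; lra.
have u2 : u ^+ b.+1 <= N.+1%:R ^+ b.+1.
  by rewrite lerXn2r ?nnegrE //; lra.
have /andP[_] := subrX_bounds R b N.+1%:R N%:R (ler0n _ _) (ltW (le_lt_trans Nu uN)).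
have N1E : N.+1%:R = N%:R + 1 :> R by rewrite natr1.
have -> : N.+1%:R - N%:R = 1 :> R by rewrite N1E addrAC subrr add0r.
rewrite mulr1 => h.
have h2 : N.+1%:R ^+ b <= (2 * u) ^+ b.
  by rewrite lerXn2r ?nnegrE //; lra.
have h3 : b.+1%:R * N.+1%:R ^+ b <= b.+1%:R * (2 * u) ^+ b.
  by rewrite ler_wpM2l // ltW.
rewrite -(ler_pM2l b0) -{1}(gtr0_norm b0) -normrM mulrBr.
rewrite [b.+1%:R * (_ / _)]mulrC divfK ?gt_eqF //.
rewrite ler_norml; apply/andP.
move: s1 s2 u1 u2 h h3; move: (N.+1%:R ^+ b.+1) (N%:R ^+ b.+1) (u ^+ b.+1).
move: (b.+1%:R * (2 * u) ^+ b) (b.+1%:R * N.+1%:R ^+ b) => p q r s t.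
by move=> *; split; lra.
Qed.

(** * Truncations of zeta and of its inverse *)

Definition zeta_sum (R : numFieldType) (b N : nat) : R :=
  \sum_(1 <= k < N.+1) (k%:R ^+ b.+1)^-1.

(** The partial sums increase, and [sum_inv_exp_tail] bounds every later one; this yields
    convergence as well as both inequalities. *)
Lemma zeta_sum_bounds (R : realType) (b N : nat) : (0 < b)%N ->
  zeta_sum R b N <= zeta (1 + b%:R : R) <=
  zeta_sum R b N + 2 / (N.+1%:R : R) ^+ b.
Proof.
move=> b0; have E : series (riemannR (1 + b%:R : R)) = zeta_sum R b.
  apply/funext => n; rewrite /series /zeta_sum big_add1 /=.
  apply: eq_bigr => k _; rewrite /riemannR addrC natr1.
  by rewrite powR_mulrn.
have cut M : (N <= M)%N -> zeta_sum R b M =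
    zeta_sum R b N + \sum_(N.+1 <= k < M.+1) (k%:R ^+ b.+1)^-1.
  by move=> NM; rewrite /zeta_sum (big_cat_nat (n := N.+1)).
have pos m n : 0 <= \sum_(m <= k < n) ((k%:R : R) ^+ b.+1)^-1.
  by rewrite sumr_ge0 // => k _; rewrite invr_ge0 exprn_ge0.
have le M : zeta_sum R b M <= zeta_sum R b N + 2 / N.+1%:R ^+ b.
  have [NM|/ltnW MN] := leqP N M.
    by rewrite cut // lerD2l sum_inv_exp_tail.
  rewrite ler_wpDr ?divr_ge0 ?exprn_ge0 //.
  rewrite /zeta_sum [leRHS](big_cat_nat (n := M.+1)) //= lerDl.
  exact: pos.
have nd : {homo zeta_sum R b : n m / (n <= m)%N >-> n <= m}.
  move=> n m nm; rewrite /zeta_sum [leRHS](big_cat_nat (n := n.+1)) //= lerDl.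
  exact: pos.
have cv : cvgn (zeta_sum R b).
  apply: nondecreasing_is_cvgn => //.
  by exists (zeta_sum R b N + 2 / N.+1%:R ^+ b) => _ [M _ <-].
rewrite /zeta E; apply/andP; split; first exact: nondecreasing_cvgn_le.
by apply: limr_le => //; near=> M; apply: le.
Unshelve. all: by end_near. Qed.

Lemma zeta_ge1 (R : realType) (b : nat) : (0 < b)%N ->
  1 <= zeta (1 + b%:R : R).
Proof.
move=> b0; have /andP[h _] := zeta_sum_bounds R b 1 b0.
by rewrite /zeta_sum big_nat1 expr1n invr1 in h.
Qed.

(* The sum of mobius m / m^(b+1) is the truncated Dirichlet series of
   1 / zeta (b+1); pairing it with the truncations of zeta at X / m gives 1. *)
Lemma sum_mobius_inv (R : realType) (b X : nat) : (0 < b)%N -> (0 < X)%N ->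
  `|\sum_(1 <= m < X.+1) (mobius m)%:~R / m%:R ^+ b.+1
    - (zeta (1 + b%:R : R))^-1| <= 2 * harmonic_sum R X / X%:R ^+ b.
Proof.
move=> b0 X0; set S := \sum_(1 <= m < X.+1) _; set Z := zeta _.
have Z1 : 1 <= Z by apply: zeta_ge1.
have X0' : (0 : R) < X%:R by rewrite ltr0n.
have one : \sum_(1 <= m < X.+1)
    (mobius m)%:~R / m%:R ^+ b.+1 * zeta_sum R b (X %/ m) = 1.
  rewrite /zeta_sum; under eq_bigr => m _ do rewrite big_distrr /=.
  rewrite -(sum_divisor_pairs _ _ (fun m k =>
    (mobius m)%:~R / m%:R ^+ b.+1 * (k%:R ^+ b.+1)^-1)).
  rewrite (eq_big_nat _ _ (F2 := fun n => (n == 1%N)%:R)); last first.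
    move=> n /andP[n0 _].
    rewrite (eq_bigr (fun m => (mobius m)%:~R / n%:R ^+ b.+1)); last first.
      move=> m mn; rewrite -mulrA -invfM -exprMn -natrM.
      by rewrite mulnC divnK.
    rewrite -big_distrl /= -rmorph_sum sum_mobius // rmorph_nat.
    by case: eqP => [->|]; rewrite ?mul0r // expr1n divr1.
  rewrite big_ltn // eqxx big_nat big1 ?addr0 // => n /andP[n1 _].
  by rewrite gtn_eqF.
have SZ : `|S * Z - 1| <= 2 * harmonic_sum R X / X%:R ^+ b.
  have -> : S * Z - 1 = \sum_(1 <= m < X.+1)
      (mobius m)%:~R / m%:R ^+ b.+1 * (Z - zeta_sum R b (X %/ m)).
    rewrite -[X in _ - X]one /S big_distrl -sumrB /=.
    by apply: eq_bigr => m _; rewrite mulrBr.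
  apply: le_trans (ler_norm_sum _ _ _) _.
  rewrite /harmonic_sum mulrAC big_distrr /=.
  apply: ler_sum_nat => m /andP[m0 mX].
  have m0' : (0 : R) < m%:R by rewrite ltr0n.
  rewrite normrM normrM normfV normrX normr_nat.
  have /andP[z1 z2] := zeta_sum_bounds R b (X %/ m) b0.
  (* The successor in the tail bound matters here: it turns [2 / (X %/ m).+1 ^ b] into at most
     [2 * m ^ b / X ^ b]. *)
  have Xm : (X%:R : R) <= m%:R * (X %/ m).+1%:R.
    by rewrite -natrM ler_nat ltnW // mulnC ltn_ceil.
  have mu1 := norm_mobius_le1 R m.
  have zz : `|Z - zeta_sum R b (X %/ m)| <= 2 * m%:R ^+ b / X%:R ^+ b.
    rewrite ger0_norm ?subr_ge0 //.
    apply: (@le_trans _ _ (2 / (X %/ m).+1%:R ^+ b)).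
      by rewrite lerBlDl.
    rewrite -mulrA ler_wpM2l // -[leRHS]invf_div lef_pV2 ?posrE ?exprn_gt0 //.
      rewrite ler_pdivrMr ?exprn_gt0 // -exprMn mulrC.
      by rewrite lerXn2r ?nnegrE // mulr_ge0.
    by rewrite divr_gt0 ?exprn_gt0.
  apply: (@le_trans _ _ (1 / m%:R ^+ b.+1 * (2 * m%:R ^+ b / X%:R ^+ b))).
    by apply: ler_pM => //; rewrite ?mulr_ge0 ?invr_ge0 ?exprn_ge0 //
      ler_wpM2r ?invr_ge0 ?exprn_ge0.
  rewrite exprS le_eqVlt; apply/orP; left; apply/eqP.
  by field; rewrite !gt_eqF ?exprn_gt0.
have Zp : 0 < Z by lra.
have -> : S - Z^-1 = (S * Z - 1) / Z by field; rewrite gt_eqF.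
rewrite normrM normfV (gtr0_norm Zp) ler_pdivrMr //.
by apply: le_trans SZ _; rewrite ler_peMr ?divr_ge0 ?mulr_ge0 ?exprn_ge0 ?harmonic_sum_ge0.
Qed.

(** * The summatory function of Jordan's totient *)

Lemma natr_div_bounds (R : numFieldType) (m d : nat) : (0 < d)%N ->
  (m %/ d)%:R <= (m%:R / d%:R : R) < (m %/ d).+1%:R.
Proof.
move=> d0; have d0' : (0 : R) < d%:R by rewrite ltr0n.
rewrite ler_pdivlMr // ltr_pdivrMr // -!natrM ler_nat ltr_nat.
by rewrite leq_trunc_div ltn_ceil.
Qed.

(** For each [m] the power sum up to [X %/ m] is replaced by [sum_exp_asymp], which costs the
    [2 ^ b]; then the sum of [mobius m / m ^ b.+1] is replaced by the inverse of zeta, which costs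
    the [2]. *)
Lemma sum_jordan_nat_asymp (R : realType) (b X : nat) : (0 < b)%N -> (0 < X)%N ->
  `|\sum_(1 <= k < X.+1) jordan R b k
    - (X%:R : R) ^+ b.+1 / (b.+1%:R * zeta (1 + b%:R))| <=
  (2 ^+ b + 2) * X%:R ^+ b * harmonic_sum R X.
Proof.
move=> b0 X0; have X1 : (1 : R) <= X%:R by rewrite ler1n.
have X0' : (0 : R) < X%:R by rewrite ltr0n.
have bp : (0 : R) < b.+1%:R by rewrite ltr0n.
have H0 := harmonic_sum_ge0 R X.
have Z1 : 1 <= zeta (1 + b%:R : R) by apply: zeta_ge1.
have := sum_mobius_inv R b X b0 X0.
set Z := zeta _ in Z1 *; set S := \sum_(1 <= m < X.+1) _ => SZ.
rewrite (sum_divisor_pairs _ _ (fun e k => (mobius e)%:~R * (k ^ b)%:R)).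
set P := \sum_(1 <= d < X.+1) _.
have PS : `|P - X%:R ^+ b.+1 / b.+1%:R * S| <=
    2 ^+ b * X%:R ^+ b * harmonic_sum R X.
  rewrite /P /S big_distrr -sumrB /=; apply: le_trans (ler_norm_sum _ _ _) _.
  rewrite /harmonic_sum big_distrr /=; apply: ler_sum_nat => m /andP[m0 mX].
  have m1 : (1 : R) <= m%:R by rewrite ler1n.
  have m0' : (0 : R) < m%:R by rewrite ltr0n.
  have -> : \sum_(1 <= k < (X %/ m).+1) (mobius m)%:~R * (k ^ b)%:R -
      X%:R ^+ b.+1 / b.+1%:R * ((mobius m)%:~R / m%:R ^+ b.+1) =
      (mobius m)%:~R * (\sum_(1 <= k < (X %/ m).+1) k%:R ^+ b -
        (X%:R / m%:R) ^+ b.+1 / b.+1%:R) :> R.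
    rewrite -big_distrr /= mulrBr expr_div_n; congr (_ * _ - _).
      by apply: eq_bigr => k _; rewrite natrX.
    by field; rewrite ?gt_eqF ?exprn_gt0.
  have h : `|\sum_(1 <= k < (X %/ m).+1) k%:R ^+ b -
      (X%:R / m%:R) ^+ b.+1 / b.+1%:R| <= (2 * (X%:R / m%:R)) ^+ b :> R.
    by apply: sum_exp_asymp; rewrite ?divn_gt0 // natr_div_bounds.
  rewrite normrM; apply: (@le_trans _ _ (1 * (2 * (X%:R / m%:R)) ^+ b)).
    by apply: ler_pM => //; apply: norm_mobius_le1.
  rewrite mul1r exprMn expr_div_n mulrA ler_wpM2l ?mulr_ge0 ?exprn_ge0 //.
  by rewrite lef_pV2 ?posrE ?exprn_gt0 // ler_eXnr.
have XX : X%:R <= X%:R ^+ b :> R by rewrite ler_eXnr.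
have SZ' : `|X%:R ^+ b.+1 / b.+1%:R * S - X%:R ^+ b.+1 / (b.+1%:R * Z)| <=
    2 * X%:R ^+ b * harmonic_sum R X.
  have -> : X%:R ^+ b.+1 / b.+1%:R * S - X%:R ^+ b.+1 / (b.+1%:R * Z) =
      X%:R ^+ b.+1 / b.+1%:R * (S - Z^-1).
    by rewrite mulrBr invfM mulrA.
  rewrite normrM ger0_norm; last by rewrite divr_ge0 ?exprn_ge0 // ltW.
  apply: (@le_trans _ _ (X%:R ^+ b.+1 * (2 * harmonic_sum R X / X%:R ^+ b))).
    apply: ler_pM => //.
    by rewrite ler_pdivrMr // ler_peMr ?exprn_ge0 // ler1n.
  (* The remainder is of size [X] times a harmonic sum, and [X <= X ^ b] as [b] is positive. *)
  have -> : X%:R ^+ b.+1 * (2 * harmonic_sum R X / X%:R ^+ b) =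
      2 * harmonic_sum R X * X%:R.
    by rewrite exprS; field; rewrite gt_eqF ?exprn_gt0.
  by rewrite mulrAC ler_wpM2r // ler_wpM2l.
have := ler_normD (P - X%:R ^+ b.+1 / b.+1%:R * S)
  (X%:R ^+ b.+1 / b.+1%:R * S - X%:R ^+ b.+1 / (b.+1%:R * Z)).
rewrite addrA subrK => h.
by apply: le_trans h _; have := lerD PS SZ'; lra.
Qed.

(** Passing from the integer part to [x] in the main term costs at most [x ^ b], whence [3] in place
    of [2]. *)
Lemma sum_jordan_asymp (R : realType) (b : nat) (x : R) : (0 < b)%N -> 1 <= x ->
  `|\sum_(1 <= k < (Num.truncn x).+1) jordan R b k
    - x ^+ b.+1 / (b.+1%:R * zeta (1 + b%:R))| <=
  (2 ^+ b + 3) * x ^+ b * (1 + ln x).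
Proof.
move=> b0 x1; have x0 : 0 <= x by lra.
set X := Num.truncn x; have X0 : (0 < X)%N by rewrite truncn_gt0.
have /andP[Xx xX] := truncn_itv x0.
have lx := ln_ge0 x1.
have Z1 : 1 <= zeta (1 + b%:R : R) by apply: zeta_ge1.
set Z := zeta _ in Z1 *.
have bp : (0 : R) < b.+1%:R by rewrite ltr0n.
have h1 : `|\sum_(1 <= k < X.+1) jordan R b k - X%:R ^+ b.+1 / (b.+1%:R * Z)|
    <= (2 ^+ b + 2) * x ^+ b * (1 + ln x).
  apply: le_trans (sum_jordan_nat_asymp R b X b0 X0) _.
  apply: ler_pM; rewrite ?mulr_ge0 ?addr_ge0 ?exprn_ge0 ?harmonic_sum_ge0 //.
    rewrite ler_wpM2l ?addr_ge0 ?exprn_ge0 //.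
    by rewrite lerXn2r ?nnegrE.
  exact: harmonic_sum_truncn.
have h2 : `|X%:R ^+ b.+1 / (b.+1%:R * Z) - x ^+ b.+1 / (b.+1%:R * Z)| <=
    x ^+ b * (1 + ln x).
  rewrite -mulrBl normrM normfV distrC.
  have /andP[_ h] := subrX_bounds R b _ _ (ler0n _ _) Xx.
  rewrite !ger0_norm ?mulr_ge0 //; last 2 first.
  - by lra.
  - by rewrite subr_ge0 lerXn2r ?nnegrE.
  rewrite ler_pdivrMr ?mulr_gt0 //; last by lra.
  apply: (le_trans h).
  have xb : 0 <= x ^+ b by rewrite exprn_ge0.
  have xX1 : x - X%:R <= 1 by move: xX; rewrite -natr1; lra.
  apply: (@le_trans _ _ (b.+1%:R * 1 * x ^+ b)).
    by rewrite ler_wpM2r // ler_wpM2l // ltW.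
  rewrite mulr1 mulrC -mulrA ler_wpM2l // mulrA [_ * b.+1%:R]mulrC -mulrA.
  rewrite ler_peMr //.
  by apply: mulr_ege1 => //; lra.
have := lerD h1 h2.
have := ler_normD (\sum_(1 <= k < X.+1) jordan R b k - X%:R ^+ b.+1 / (b.+1%:R * Z))
  (X%:R ^+ b.+1 / (b.+1%:R * Z) - x ^+ b.+1 / (b.+1%:R * Z)).
rewrite addrA subrK => h3 h4; apply: le_trans h3 (le_trans h4 _).
lra.
Qed.

(** * The asymptotic formula with fractional parts dropped *)

Lemma norm_mertens_le (R : numDomainType) (N : nat) : `|mertens R N| <= N%:R.
Proof.
apply: le_trans (ler_norm_sum _ _ _) _.
apply: (@le_trans _ _ (\sum_(1 <= m < N.+1) 1)).
  by apply: ler_sum_nat => m _; apply: norm_mobius_le1.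
by rewrite big_const_nat subSS subn0 iter_addr_0.
Qed.

(** Of the [b] factors [d], one is absorbed by [d * (X %/ d) <= X] and the others are at most
    [X]. *)
Lemma norm_weight_le (R : numDomainType) (b X d : nat) :
  (0 < b)%N -> (d <= X)%N -> `|weight R b X d| <= X%:R ^+ b.
Proof.
move=> b0 dX; rewrite /weight normrM normr_nat.
apply: (@le_trans _ _ ((d ^ b)%:R * (X %/ d)%:R)).
  by rewrite ler_wpM2l // norm_mertens_le.
rewrite -natrX -natrM ler_nat -(prednK b0) !expnSr -mulnA leq_mul //.
  by case: b.-1 => [//|n]; rewrite leq_exp2r.
by rewrite mulnC leq_trunc_div.
Qed.

Lemma sum_norm_weight_le (R : numDomainType) (b X : nat) : (0 < b)%N ->
  \sum_(1 <= d < X.+1) `|weight R b X d| <= X%:R ^+ b.+1.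
Proof.
move=> b0; apply: (@le_trans _ _ (\sum_(1 <= d < X.+1) X%:R ^+ b)).
  by apply: ler_sum_nat => d /andP[_ dX]; apply: norm_weight_le.
by rewrite big_const_nat subSS subn0 iter_addr_0 exprS mulr_natl.
Qed.

(** By [sum_weight_lcm] the difference is the quadratic form with fractional parts as coefficients,
    so the square of the sum of the absolute weights bounds it. *)
Lemma C2_real_jordan (R : realType) (b : nat) (x y : R) : (0 < b)%N -> 0 <= x ->
  `|C2_real R b x y - (Num.truncn y)%:R *
     \sum_(1 <= k < (Num.truncn x).+1) jordan R b k| <= x ^+ (2 * b + 2).
Proof.
move=> b0 x0; rewrite /C2_real; set X := Num.truncn x; set Y := Num.truncn y.
apply: (@le_trans _ _ ((X%:R ^+ b.+1) ^+ 2)); last first.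
  rewrite -exprM mulSn addnC mulnC -/(_ + 2)%N.
  by rewrite lerXn2r ?nnegrE // /X truncn_le.
rewrite -sum_weight_lcm big_distrr -sumrB /=.
apply: le_trans (ler_norm_sum _ _ _) _.
apply: (@le_trans _ _ ((\sum_(1 <= d < X.+1) `|weight R b X d|) ^+ 2)); last first.
  rewrite lerXn2r ?nnegrE ?sum_norm_weight_le ?exprn_ge0 //.
  by rewrite sumr_ge0.
rewrite expr2 big_distrl /=; apply: ler_sum_nat => d /andP[d0 _].
rewrite !big_distrr -sumrB /=; apply: le_trans (ler_norm_sum _ _ _) _.
apply: ler_sum_nat => e /andP[e0 _].
have l0 : (0 < lcmn d e ^ b)%N by rewrite expn_gt0 lcmn_gt0 d0 e0.
have /andP[h1 h2] := natr_div_bounds R Y _ l0.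
set l := (lcmn d e ^ b)%N in l0 h1 h2 *.
have -> : weight R b X d * weight R b X e * (Y %/ l)%:R -
    Y%:R * (weight R b X d * weight R b X e / l%:R) =
    weight R b X d * weight R b X e * ((Y %/ l)%:R - Y%:R / l%:R) by ring.
rewrite 2!normrM ler_piMr ?mulr_ge0 // ler0_norm ?subr_le0 //.
by rewrite -natr1 in h2; lra.
Qed.

(** Replacing [Num.truncn y] by [y] in the main term costs [x ^ b.+1], which [x <= y] absorbs into
    [y * x ^ b]. *)
Lemma C2_real_asymp (R : realType) (b : nat) (x y : R) :
  (0 < b)%N -> 1 <= x -> x <= y ->
  `|C2_real R b x y - y * x ^+ (1 + b) / ((1 + b%:R) * zeta (1 + b%:R))| <=
  (2 ^+ b + 4) * (y * x ^+ b * (1 + ln x)) + x ^+ (2 * b + 2).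
Proof.
move=> b0 x1 xy; have x0 : 0 <= x by lra.
have y0 : 0 <= y by lra.
have h1 := C2_real_jordan R b x y b0 x0.
have h2 := sum_jordan_asymp R b x b0 x1.
set P := \sum_(1 <= k < _) _ in h1 h2.
have Z1 : 1 <= zeta (1 + b%:R : R) by apply: zeta_ge1.
set Z := zeta _ in Z1 h2 *.
have /andP[Yy yY] := truncn_itv y0; set Y := Num.truncn y in h1 Yy yY *.
rewrite add1n; have -> : 1 + b%:R = b.+1%:R :> R by rewrite addrC natr1.
have bZ : 1 <= b.+1%:R * Z by rewrite mulr_ege1 // ler1n.
set c := b.+1%:R * Z in h2 bZ *.
have xb : 0 <= x ^+ b by rewrite exprn_ge0.
have lx := ln_ge0 x1.
have h3 : `|Y%:R * P - Y%:R * (x ^+ b.+1 / c)| <=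
    (2 ^+ b + 3) * (y * x ^+ b * (1 + ln x)).
  rewrite -mulrBr normrM normr_nat.
  apply: (@le_trans _ _ (y * ((2 ^+ b + 3) * x ^+ b * (1 + ln x)))).
    by apply: ler_pM.
  by rewrite le_eqVlt; apply/orP; left; apply/eqP; ring.
have h4 : `|Y%:R * (x ^+ b.+1 / c) - y * x ^+ b.+1 / c| <=
    y * x ^+ b * (1 + ln x).
  rewrite -mulrA -mulrBl normrM.
  have n1 : `|Y%:R - y| <= 1.
    by rewrite ler_norml; rewrite -natr1 in yY; apply/andP; split; lra.
  have n2 : `|x ^+ b.+1 / c| <= x ^+ b.+1.
    rewrite ger0_norm ?divr_ge0 ?exprn_ge0 //; last by lra.
    by rewrite ler_pdivrMr ?ler_peMr ?exprn_ge0 //; lra.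
  apply: (@le_trans _ _ (1 * x ^+ b.+1)); first by apply: ler_pM.
  rewrite mul1r exprS -[leLHS]mulr1.
  by apply: ler_pM => //; rewrite ?mulr_ge0 ?ler_wpM2r //; lra.
have := lerD (lerD h1 h3) h4.
have := ler_normD (C2_real R b x y - Y%:R * P + (Y%:R * P - Y%:R * (x ^+ b.+1 / c)))
   (Y%:R * (x ^+ b.+1 / c) - y * x ^+ b.+1 / c).
have := ler_normD (C2_real R b x y - Y%:R * P) (Y%:R * P - Y%:R * (x ^+ b.+1 / c)).
rewrite !addrA !subrK; lra.
Qed.

(** * The hyperbola method for sums of [a * (N %/ a)] *)

Lemma sum_natr (R : numFieldType) (n : nat) :
  \sum_(1 <= a < n.+1) a%:R = n%:R * (n%:R + 1) / 2 :> R.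
Proof.
elim: n => [|n IH]; first by rewrite big_geq // !mul0r.
by rewrite big_nat_recr //= IH -[n.+1%:R]natr1; field.
Qed.

(** Midpoints make each term differ from its telescoping substitute by only
    [1 / (b ^ 2 * (4 * b ^ 2 - 1))]. An error of order [1 / B ^ 2] would be too large, since it is
    later multiplied by [N ^ 2]. *)
Lemma sum_inv_sqr_midpoint (R : realFieldType) (B N : nat) :
  (0 < B)%N -> (B <= N)%N ->
  `|\sum_(B.+1 <= b < N.+1) (b%:R ^+ 2)^-1
     - ((B%:R + 1 / 2)^-1 - (N%:R + 1 / 2)^-1)| <= (B%:R ^+ 3)^-1 :> R.
Proof.
move=> B0 BN; have B0' : (0 : R) < B%:R by rewrite ltr0n.
have <- : \sum_(B <= b < N) (- (b.+1%:R + 1 / 2)^-1 - (- (b%:R + 1 / 2)^-1))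
    = (B%:R + 1 / 2)^-1 - (N%:R + 1 / 2)^-1 :> R.
  by rewrite (telescope_sumr (fun b => - (b%:R + 1 / 2)^-1)) // opprK addrC.
rewrite big_add1 /= -sumrB; apply: le_trans (ler_norm_sum _ _ _) _.
apply: (@le_trans _ _ ((B%:R ^+ 2)^-1 * \sum_(B.+1 <= b < N.+1) (b%:R ^+ 2)^-1)).
  rewrite big_distrr big_add1 /=; apply: ler_sum_nat => b /andP[Bb _].
  have b1 : (B%:R : R) <= b%:R by rewrite ler_nat.
  rewrite -[b.+1%:R]natr1; set u : R := b%:R in b1 *.
  have u0 : 0 < u by lra.
  have -> : ((u + 1) ^+ 2)^-1 - (- (u + 1 + 1 / 2)^-1 - - (u + 1 / 2)^-1) =
      - (((u + 1) ^+ 2)^-1 * (4 * (u + 1 + 1 / 2) * (u + 1 / 2))^-1).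
    by field; rewrite !gt_eqF //; lra.
  rewrite normrN ger0_norm; last first.
    by rewrite mulr_ge0 ?invr_ge0 ?exprn_ge0 ?mulr_ge0 //; lra.
  rewrite mulrC ler_wpM2r ?invr_ge0 ?exprn_ge0 //; first by lra.
  rewrite lef_pV2 ?posrE ?exprn_gt0 ?mulr_gt0 //; try lra.
  by nra.
have -> : (B%:R ^+ 3)^-1 = (B%:R ^+ 2)^-1 * B%:R^-1 :> R by rewrite exprSr invfM.
by rewrite ler_wpM2l ?invr_ge0 ?exprn_ge0 ?sum_inv_sqr_le.
Qed.

Lemma triangular_floor (R : realFieldType) (k : nat) (u : R) :
  k%:R <= u < k.+1%:R -> `|k%:R * (k%:R + 1) / 2 - u ^+ 2 / 2| <= u / 2.
Proof.
rewrite -natr1 => /andP[ku uk]; have k0 : (0 : R) <= k%:R by [].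
rewrite ler_norml; apply/andP; split; nra.
Qed.

(** Counts the points with [a * b <= N] and [a <= A] by columns [b]: up to [N %/ A] the whole range
    of [a] occurs, beyond it only [a <= N %/ b]. *)
Lemma sum_mul_divn (R : numFieldType) (A N : nat) : (0 < A <= N)%N ->
  \sum_(1 <= a < A.+1) a%:R * (N %/ a)%:R =
  (N %/ A)%:R * (A%:R * (A%:R + 1) / 2) +
  \sum_((N %/ A).+1 <= b < N.+1) (N %/ b)%:R * ((N %/ b)%:R + 1) / 2 :> R.
Proof.
move=> /andP[A0 AN]; pose f a : R := if (a <= A)%N then a%:R else 0.
have fE n : (n <= A)%N -> \sum_(1 <= a < n.+1) f a = n%:R * (n%:R + 1) / 2.
  move=> nA; rewrite -sum_natr; apply: eq_big_nat => a /andP[_ an].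
  by rewrite ltnS in an; rewrite /f (leq_trans an nA).
transitivity (\sum_(1 <= a < N.+1) \sum_(1 <= b < (N %/ a).+1) f a).
  rewrite [RHS](big_cat_nat (n := A.+1)) //= [X in _ = _ + X]big_nat.
  rewrite [X in _ = _ + X]big1 ?addr0; last first.
    by move=> a /andP[Aa _]; rewrite big1 // => b _; rewrite /f leqNgt Aa.
  apply: eq_big_nat => a /andP[_ aA]; rewrite big_const_nat subSS subn0.
  by rewrite ltnS in aA; rewrite iter_addr_0 /f aA mulr_natr.
rewrite exchange_hyperbola [LHS](big_cat_nat (n := (N %/ A).+1)) //=; last first.
  by rewrite ltnS leq_div.
congr (_ + _).
  rewrite (eq_big_nat _ _ (F2 := fun=> A%:R * (A%:R + 1) / 2)); last first.
    move=> b /andP[b0 bB]; rewrite -fE //.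
    have Ab : (A <= N %/ b)%N by rewrite leq_divRL // mulnC -leq_divRL.
    rewrite [LHS](big_cat_nat (n := A.+1)) //= [X in _ + X]big_nat.
    rewrite [X in _ + X]big1 ?addr0 // => a /andP[Aa _].
    by rewrite /f leqNgt Aa.
  by rewrite big_const_nat subSS subn0 iter_addr_0 -[LHS]mulr_natl.
apply: eq_big_nat => b /andP[Bb bN]; have b0 : (0 < b)%N by apply: leq_trans Bb.
by rewrite fE // ltnW // ltn_divLR // mulnC -ltn_divLR.
Qed.

(* With B = N %/ A the main terms combine into
   (A^2/2) (B + 1/2 - N/A)^2 / (B + 1/2), which is O(A^3/N). *)
Lemma sum_mul_divn_asymp (R : realFieldType) (A N : nat) : (0 < A <= N)%N ->
  `|\sum_(1 <= a < A.+1) a%:R * (N %/ a)%:R - (A%:R * N%:R - A%:R ^+ 2 / 4)| <=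
  5 * (A%:R ^+ 3 / N%:R) + N%:R * (1 + harmonic_sum R N) :> R.
Proof.
move=> /andP[A0 AN]; rewrite sum_mul_divn ?A0 //.
have B0 : (0 < N %/ A)%N by rewrite divn_gt0.
have BN : (N %/ A <= N)%N by apply: leq_div.
have BA : (N %/ A)%:R * A%:R <= N%:R :> R by rewrite -natrM ler_nat leq_trunc_div.
have AB : N%:R <= ((N %/ A)%:R + 1) * A%:R :> R.
  by rewrite natr1 -natrM ler_nat ltnW // ltn_ceil.
have T1 := sum_inv_sqr_midpoint R _ _ B0 BN.
have a1 : (1 : R) <= A%:R by rewrite ler1n.
have b1 : (1 : R) <= (N %/ A)%:R by rewrite ler1n.
have an : (A%:R : R) <= N%:R by rewrite ler_nat.
set S2 := \sum_(_ <= b < _) (_ / 2); set T := \sum_(_ <= b < _) _^-1 in T1.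
have S2T : `|S2 - N%:R ^+ 2 / 2 * T| <= N%:R / 2 * harmonic_sum R N.
  rewrite /S2 /T big_distrr -sumrB /=; apply: le_trans (ler_norm_sum _ _ _) _.
  apply: (@le_trans _ _ (\sum_((N %/ A).+1 <= b < N.+1) N%:R / 2 * b%:R^-1)).
    apply: ler_sum_nat => b /andP[Bb bN]; have b0 : (0 < b)%N by lia.
    have bp : (0 : R) < b%:R by rewrite ltr0n.
    have -> : N%:R ^+ 2 / 2 * (b%:R ^+ 2)^-1 = (N%:R / b%:R) ^+ 2 / 2 :> R.
      by field; rewrite gt_eqF.
    have -> : N%:R / 2 * b%:R^-1 = N%:R / b%:R / 2 :> R.
      by field; rewrite gt_eqF.
    apply: triangular_floor; rewrite ler_pdivlMr // ltr_pdivrMr // -!natrM.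
    by rewrite ler_nat ltr_nat leq_trunc_div ltn_ceil.
  rewrite -big_distrr /= ler_wpM2l ?divr_ge0 //.
  rewrite /harmonic_sum [leRHS](big_cat_nat (n := (N %/ A).+1)) //=.
  by rewrite lerDr sumr_ge0 // => m _; rewrite invr_ge0.
have H0 := harmonic_sum_ge0 R N.
move: T1 S2T H0 BA AB a1 b1 an.
move: (harmonic_sum R N) S2 T (N %/ A)%:R A%:R N%:R => H S2 T b a n.
move=> T1 S2T H0 BA AB a1 b1 an {A N A0 AN B0 BN}.
have n0 : 0 < n by lra.
have a0 : 0 < a by lra.
have b0 : 0 < b + 1 / 2 by lra.
have M1 : `|a ^+ 2 / 2 * (b + 1 / 2) + n ^+ 2 / 2 * (b + 1 / 2)^-1 - a * n|
    <= a ^+ 3 / n.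
  have -> : a ^+ 2 / 2 * (b + 1 / 2) + n ^+ 2 / 2 * (b + 1 / 2)^-1 - a * n =
      (a * (b + 1 / 2) - n) ^+ 2 / (2 * (b + 1 / 2)).
    by field; rewrite gt_eqF //; lra.
  rewrite ger0_norm; last by rewrite divr_ge0 ?sqr_ge0 //; lra.
  rewrite ler_pdivrMr; last by lra.
  apply: (@le_trans _ _ (a ^+ 2)).
    (* As [b] is the integer part of [n / a], the point [a * (b + 1 / 2)] is within [a / 2] of
       [n]. *)
    have h1 : a * (b + 1 / 2) - n <= a / 2 by lra.
    have h2 : - (a / 2) <= a * (b + 1 / 2) - n by lra.
    nra.
  rewrite mulrAC ler_pdivlMr // exprS mulrAC.
  by rewrite [leRHS]mulrC mulrA -subr_ge0 -[X in _ - X]mulr1; nra.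
have M2 : `|n ^+ 2 / 2 * (T - ((b + 1 / 2)^-1 - (n + 1 / 2)^-1))| <=
    4 * (a ^+ 3 / n).
  rewrite normrM ger0_norm; last by rewrite divr_ge0 ?sqr_ge0.
  apply: (@le_trans _ _ (n ^+ 2 / 2 * (b ^+ 3)^-1)).
    by rewrite ler_wpM2l // divr_ge0 ?sqr_ge0.
  (* Cubing this gives [n ^ 3 <= 8 * (a * b) ^ 3], hence the constant [4] after halving. *)
  have nab : n <= 2 * (a * b) by nra.
  have n3 : n ^+ 3 <= (2 * (a * b)) ^+ 3.
    by rewrite lerXn2r ?nnegrE //; [rewrite ltW | rewrite !mulr_ge0 //; lra].
  rewrite ler_pdivrMr ?exprn_gt0 //; last by lra.
  rewrite -(ler_pM2r n0).
  have -> : 4 * (a ^+ 3 / n) * b ^+ 3 * n = 4 * a ^+ 3 * b ^+ 3.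
    by field; rewrite gt_eqF.
  rewrite !exprS !expr0 in n3 *; nra.
have r0 : 0 <= n ^+ 2 / 2 * (n + 1 / 2)^-1.
  by rewrite mulr_ge0 ?invr_ge0 ?divr_ge0 ?sqr_ge0 //; lra.
have r1 : n ^+ 2 / 2 * (n + 1 / 2)^-1 <= n / 2.
  by rewrite ler_pdivrMr; [rewrite expr2; nra | lra].
(* After the three comparisons only a linear term and the far end of the midpoint formula remain,
   each at most [n / 2]. *)
have -> : b * (a * (a + 1) / 2) + S2 - (a * n - a ^+ 2 / 4) =
    (S2 - n ^+ 2 / 2 * T) + n ^+ 2 / 2 * (T - ((b + 1 / 2)^-1 - (n + 1 / 2)^-1))
    + (a ^+ 2 / 2 * (b + 1 / 2) + n ^+ 2 / 2 * (b + 1 / 2)^-1 - a * n)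
    + (b * a / 2 - n ^+ 2 / 2 * (n + 1 / 2)^-1).
  by field; rewrite !gt_eqF //; lra.
have M3 : `|b * a / 2 - n ^+ 2 / 2 * (n + 1 / 2)^-1| <= n / 2.
  have : 0 <= b * a by rewrite mulr_ge0 //; lra.
  by move=> ba; rewrite ler_norml; apply/andP; split; lra.
apply: le_trans (ler_normD _ _) _.
have h1 := ler_normD (S2 - n ^+ 2 / 2 * T)
  (n ^+ 2 / 2 * (T - ((b + 1 / 2)^-1 - (n + 1 / 2)^-1))).
have h2 := ler_normD (S2 - n ^+ 2 / 2 * T +
  n ^+ 2 / 2 * (T - ((b + 1 / 2)^-1 - (n + 1 / 2)^-1)))
  (a ^+ 2 / 2 * (b + 1 / 2) + n ^+ 2 / 2 * (b + 1 / 2)^-1 - a * n).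
have nH : 0 <= n * H by rewrite mulr_ge0 // ltW.
lra.
Qed.

(** * Sawtooth sums *)

Definition sawtooth (R : numFieldType) (Y D : nat) : R :=
  Y%:R / D%:R - (Y %/ D)%:R - 1 / 2.

Lemma norm_sawtooth_le (R : realFieldType) (Y D : nat) : (0 < D)%N ->
  `|sawtooth R Y D| <= 1 / 2.
Proof.
move=> D0; have D0' : (0 : R) < D%:R by rewrite ltr0n.
have h1 : (Y %/ D)%:R <= Y%:R / D%:R :> R.
  by rewrite ler_pdivlMr // -natrM ler_nat leq_trunc_div.
have h2 : Y%:R / D%:R <= (Y %/ D)%:R + 1 :> R.
  by rewrite natr1 ler_pdivrMr // -natrM ler_nat ltnW // ltn_ceil.
by rewrite /sawtooth ler_norml; apply/andP; split; lra.
Qed.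

Definition sawtooth_sum (R : numFieldType) (Y D A : nat) : R :=
  \sum_(1 <= a < A.+1) a%:R * sawtooth R Y (D * a).

Lemma norm_sawtooth_sum_triv (R : realFieldType) (Y D A : nat) : (0 < D)%N ->
  `|sawtooth_sum R Y D A| <= A%:R ^+ 2.
Proof.
move=> D0; apply: le_trans (ler_norm_sum _ _ _) _.
apply: (@le_trans _ _ (\sum_(1 <= a < A.+1) A%:R)).
  apply: ler_sum_nat => a /andP[a0 aA]; rewrite normrM normr_nat.
  have h : `|sawtooth R Y (D * a)| <= 1.
    by apply: le_trans (norm_sawtooth_le _ _ _ _) _; rewrite ?muln_gt0 ?D0 //; lra.
  by rewrite -[leRHS]mulr1; apply: ler_pM => //; rewrite ler_nat.
by rewrite big_const_nat subSS subn0 iter_addr_0 expr2 mulr_natr.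
Qed.

(** With [V = Y / D], the trivial bound suffices for [A <= sqrt V] and for [A >= V]. In between,
    [sum_mul_divn_asymp] at [Y %/ D] cancels the main terms, and its error of size [V] times a
    logarithm is at most [A * sqrt V] times that logarithm. *)
Lemma norm_sawtooth_sum_le (R : rcfType) (Y D A : nat) : (0 < D)%N -> (0 < Y)%N ->
  `|sawtooth_sum R Y D A| <= 10 * (A%:R ^+ 3 / (Y%:R / D%:R)) +
    3 * A%:R * Num.sqrt (Y%:R / D%:R) * (1 + harmonic_sum R Y).
Proof.
move=> D0 Y0; set V : R := Y%:R / D%:R; have D0' : (0 : R) < D%:R by rewrite ltr0n.
have V0 : 0 < V by rewrite divr_gt0 // ltr0n.
have q0 : 0 <= Num.sqrt V by apply: sqrtr_ge0.
have H0 := harmonic_sum_ge0 R Y.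
have triv := norm_sawtooth_sum_triv R Y D A D0.
have a0 : (0 : R) <= A%:R by [].
have p1 : 0 <= A%:R ^+ 3 / V by rewrite divr_ge0 ?exprn_ge0 // ltW.
have p2 : 0 <= A%:R * Num.sqrt V by rewrite mulr_ge0.
have p3 : 0 <= A%:R * Num.sqrt V * harmonic_sum R Y by rewrite mulr_ge0.
have qV : Num.sqrt V * Num.sqrt V = V by rewrite -expr2 sqr_sqrtr // ltW.
have [Aq|qA] := lerP A%:R (Num.sqrt V).
  apply: le_trans triv _.
  have : A%:R ^+ 2 <= A%:R * Num.sqrt V by rewrite expr2 ler_wpM2l.
  by move=> *; lra.
have [VA|AV] := lerP V A%:R.
  apply: le_trans triv _.
  have : A%:R ^+ 2 <= A%:R ^+ 3 / V.
    by rewrite ler_pdivlMr // [leRHS]exprSr ler_wpM2l ?exprn_ge0.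
  by move=> *; lra.
have A0 : (0 < A)%N by rewrite -(ltr0n R) (le_lt_trans q0).
have AN : (A <= Y %/ D)%N.
  by rewrite leq_divRL // -(ler_nat R) natrM -ler_pdivlMr // ltW.
have NV : (Y %/ D)%:R <= V by rewrite ler_pdivlMr // -natrM ler_nat leq_trunc_div.
have VN : V <= (Y %/ D)%:R + 1.
  by rewrite natr1 ler_pdivrMr // -natrM ler_nat ltnW // ltn_ceil.
have := sum_mul_divn_asymp R A (Y %/ D); rewrite A0 AN => /(_ isT).
have HNY : harmonic_sum R (Y %/ D) <= harmonic_sum R Y.
  by apply/le_harmonic_sum/leq_div.
have -> : sawtooth_sum R Y D A = A%:R * V - A%:R * (A%:R + 1) / 4 -
    \sum_(1 <= a < A.+1) a%:R * (Y %/ D %/ a)%:R.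
  have -> : A%:R * V - A%:R * (A%:R + 1) / 4 =
      \sum_(1 <= a < A.+1) (V - a%:R / 2) :> R.
    transitivity (\sum_(1 <= a < A.+1) V - (\sum_(1 <= a < A.+1) a%:R) / 2).
      rewrite sum_natr big_const_nat subSS subn0 iter_addr_0 -mulr_natl.
      by field.
    by rewrite mulr_suml sumrB.
  rewrite -sumrB; apply: eq_big_nat => a /andP[a1 _].
  rewrite /sawtooth divnMA natrM /V.
  by field; rewrite !gt_eqF // ltr0n.
have N1 : (1 : R) <= (Y %/ D)%:R by rewrite ler1n (leq_trans A0).
have AN' : A%:R <= (Y %/ D)%:R :> R by rewrite ler_nat.
have A1 : (1 : R) <= A%:R by rewrite ler1n.
have HN0 := harmonic_sum_ge0 R (Y %/ D).
move: N1 AN' A1 NV VN HNY HN0; set S := \sum_(_ <= a < _) _.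
move: (Y %/ D)%:R (harmonic_sum R (Y %/ D)) => n h N1 AN' A1 NV VN HNY HN0 core.
have n0 : 0 < n by lra.
have c1 : A%:R ^+ 3 / n <= 2 * (A%:R ^+ 3 / V).
  rewrite ler_pdivrMr // -[leRHS]mulrA mulrCA -[leLHS](divfK (lt0r_neq0 V0)).
  by rewrite ler_wpM2l //; lra.
have nq : n <= A%:R * Num.sqrt V.
  by apply: (le_trans NV); rewrite -{1}qV ler_wpM2r // ltW.
have c2 : n * (1 + h) <= A%:R * Num.sqrt V * (1 + harmonic_sum R Y).
  by apply: ler_pM => //; lra.
have AVn : A%:R * n <= A%:R * V by rewrite ler_wpM2l.
have AVn' : A%:R * V <= A%:R * n + A%:R.
  by rewrite -{3}[A%:R]mulr1 -mulrDr ler_wpM2l.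
move: core; rewrite !ler_norml => /andP[e1 e2]; apply/andP; split; lra.
Qed.

(** * Sums over divisor chains *)

Lemma sum_inv_sqrt_le (R : rcfType) (N : nat) :
  \sum_(1 <= j < N.+1) (Num.sqrt (j%:R : R))^-1 <= 2 * Num.sqrt N%:R.
Proof.
elim: N => [|N IH]; first by rewrite big_geq // sqrtr0 mulr0.
rewrite big_nat_recr //=.
have v0 : 0 < Num.sqrt (N.+1%:R : R) by rewrite sqrtr_gt0 ltr0n.
have u0 : 0 <= Num.sqrt (N%:R : R) by apply: sqrtr_ge0.
have E : Num.sqrt (N.+1%:R : R) ^+ 2 = Num.sqrt (N%:R : R) ^+ 2 + 1.
  by rewrite !sqr_sqrtr // natr1.
move: IH v0 u0 E; move: (\sum_(1 <= j < N.+1) _) (Num.sqrt _) (Num.sqrt _).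
move=> s v u IH v0 u0 E; rewrite -lerBrDl.
apply: (@le_trans _ _ (2 * v - 2 * u)); last by lra.
rewrite -(ler_pM2r v0) mulVf ?gt_eqF //.
by rewrite !expr2 in E; nra.
Qed.

(** Telescoping: for positive [u], [v] with [v ^ 2 = u ^ 2 + 1] one has
    [1 / v ^ 3 <= 2 / u - 2 / v]. The subtracted term in [h] makes the induction close. *)
Lemma sum_inv_mul_sqrt_le (R : rcfType) (N : nat) :
  \sum_(1 <= j < N.+1) (j%:R * Num.sqrt (j%:R : R))^-1 <= 3.
Proof.
suff h n : \sum_(1 <= j < n.+2) (j%:R * Num.sqrt (j%:R : R))^-1 <=
    3 - 2 / Num.sqrt n.+1%:R.
  case: N => [|N]; first by rewrite big_geq.
  by apply: le_trans (h N) _; rewrite gerBl divr_ge0 ?sqrtr_ge0.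
elim: n => [|n IH]; first by rewrite big_nat1 sqrtr1 mulr1 invr1; lra.
rewrite big_nat_recr //=.
have v0 : 0 < Num.sqrt (n.+2%:R : R) by rewrite sqrtr_gt0 ltr0n.
have u0 : 0 < Num.sqrt (n.+1%:R : R) by rewrite sqrtr_gt0 ltr0n.
have E : Num.sqrt (n.+2%:R : R) ^+ 2 = Num.sqrt (n.+1%:R : R) ^+ 2 + 1.
  by rewrite !sqr_sqrtr // natr1.
have E2 : n.+2%:R = Num.sqrt (n.+2%:R : R) ^+ 2 by rewrite sqr_sqrtr.
rewrite {1}E2 {E2}.
move: IH v0 u0 E.
move: (\sum_(1 <= j < n.+2) _) (Num.sqrt _) (Num.sqrt _).
move=> s v u IH v0 u0 E; rewrite -lerBrDl.
apply: (@le_trans _ _ (2 / u - 2 / v)); last by lra.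
rewrite -subr_ge0.
have -> : 2 / u - 2 / v - (v ^+ 2 * v)^-1 =
    (2 * v ^+ 2 * (v - u) - u) / (u * v ^+ 3).
  by field; rewrite !gt_eqF.
rewrite divr_ge0 ?mulr_ge0 ?exprn_ge0 //; try exact: ltW.
have uv : u <= v by rewrite !expr2 in E; nra.
have vu : (v - u) * (v + u) = 1 by rewrite !expr2 in E; nra.
have h : 1 <= (v - u) * (2 * v) by nra.
rewrite subr_ge0; apply: (le_trans uv).
by rewrite expr2; nra.
Qed.

(** There are at most [X / k] multiples [d] of [k]. Then [k = f * j] leaves the sums of [1 / f ^ 2]
    and [1 / j ^ 3], each at most [2]. *)
Lemma sum_divisor_chain_cube (R : realFieldType) (X : nat) :
  \sum_(1 <= d < X.+1) \sum_(1 <= k < d.+1 | (k %| d)%N)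
    \sum_(1 <= f < k.+1 | (f %| k)%N) f%:R / k%:R ^+ 2 <= 4 * X%:R :> R.
Proof.
rewrite (sum_divisor_pairs _ _ (fun k _ =>
  \sum_(1 <= f < k.+1 | (f %| k)%N) f%:R / k%:R ^+ 2)).
apply: (@le_trans _ _ (X%:R * \sum_(1 <= k < X.+1)
    \sum_(1 <= f < k.+1 | (f %| k)%N) f%:R / (f%:R * (k %/ f)%:R) ^+ 3)).
  rewrite big_distrr /=; apply: ler_sum_nat => k /andP[k0 _].
  have k0' : (0 : R) < k%:R by rewrite ltr0n.
  rewrite big_const_nat subSS subn0 iter_addr_0 -[leLHS]mulr_natl.
  rewrite [X in _ * X <= _](_ : _ = k%:R *
    \sum_(1 <= f < k.+1 | (f %| k)%N) f%:R / (f%:R * (k %/ f)%:R) ^+ 3).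
    by rewrite mulrA ler_wpM2r ?sumr_ge0 -?natrM ?ler_nat ?leq_trunc_div.
  rewrite big_distrr /=; apply: eq_bigr => f fk.
  by rewrite -natrM [(f * _)%N]mulnC divnK //; field; rewrite gt_eqF.
rewrite (sum_divisor_pairs _ _ (fun f j => f%:R / (f%:R * j%:R) ^+ 3)).
rewrite [leRHS]mulrC ler_wpM2l //.
have two b : (0 < b)%N -> \sum_(1 <= k < X.+1) ((k%:R : R) ^+ b.+1)^-1 <= 2.
  by move=> b0; have := sum_inv_exp_tail R b 0 X.+1 b0; rewrite expr1n divr1.
apply: (@le_trans _ _ (\sum_(1 <= f < X.+1) (f%:R ^+ 2)^-1 * 2)).
  apply: ler_sum_nat => f /andP[f0 fX].
  have f0' : (0 : R) < f%:R by rewrite ltr0n.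
  rewrite [X in X <= _](_ : _ = (f%:R ^+ 2)^-1 *
      \sum_(1 <= j < (X %/ f).+1) (j%:R ^+ 3)^-1).
    rewrite ler_wpM2l ?invr_ge0 ?exprn_ge0 //.
    by have := sum_inv_exp_tail R 2 0 (X %/ f).+1 isT; rewrite expr1n divr1.
  rewrite big_distrr /=; apply: eq_big_nat => j /andP[j0 _].
  by field; rewrite !gt_eqF // ltr0n.
by rewrite -big_distrl /=; have := two 1%N isT; lra.
Qed.

(** Summing over [d %/ k] gives [2 * sqrt (X / k)]; then [k = f * j] separates a sum of [f] to the
    power [-3/2], at most [3], from a harmonic sum in [j]. *)
Lemma sum_divisor_chain_sqrt (R : rcfType) (X : nat) :
  \sum_(1 <= d < X.+1) \sum_(1 <= k < d.+1 | (k %| d)%N)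
    \sum_(1 <= f < k.+1 | (f %| k)%N)
      (Num.sqrt d%:R * Num.sqrt f%:R)^-1 <=
  6 * Num.sqrt X%:R * harmonic_sum R X.
Proof.
have sq0 n : 0 <= Num.sqrt (n%:R : R) by apply: sqrtr_ge0.
have sqn0 n : (0 < n)%N -> Num.sqrt (n%:R : R) != 0.
  by move=> n0; rewrite gt_eqF // sqrtr_gt0 ltr0n.
have sqM m n : Num.sqrt ((m * n)%:R : R) = Num.sqrt m%:R * Num.sqrt n%:R.
  by rewrite natrM sqrtrM.
pose g k : R := \sum_(1 <= f < k.+1 | (f %| k)%N) (Num.sqrt f%:R)^-1.
have g0 k : 0 <= g k by rewrite sumr_ge0 // => f _; rewrite invr_ge0.
have -> : \sum_(1 <= d < X.+1) \sum_(1 <= k < d.+1 | (k %| d)%N)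
    \sum_(1 <= f < k.+1 | (f %| k)%N) (Num.sqrt d%:R * Num.sqrt f%:R)^-1 =
  \sum_(1 <= d < X.+1) \sum_(1 <= k < d.+1 | (k %| d)%N)
    (Num.sqrt k%:R)^-1 * (Num.sqrt (d %/ k)%:R)^-1 * g k.
  apply: eq_bigr => d _; apply: eq_bigr => k kd.
  rewrite -invfM -sqM mulnC divnK // /g big_distrr /=.
  by apply: eq_bigr => f _; rewrite invfM.
rewrite (sum_divisor_pairs _ _ (fun k j =>
  (Num.sqrt k%:R)^-1 * (Num.sqrt j%:R)^-1 * g k)).
apply: (@le_trans _ _ (\sum_(1 <= k < X.+1) 2 * Num.sqrt X%:R * (k%:R^-1 * g k))).
  apply: ler_sum_nat => k /andP[k0 kX].
  rewrite -big_distrl -big_distrr /= mulrA ler_wpM2r //.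
  apply: (@le_trans _ _ ((Num.sqrt k%:R)^-1 * (2 * Num.sqrt (X %/ k)%:R))).
    by rewrite ler_wpM2l ?invr_ge0 ?sum_inv_sqrt_le.
  have h : Num.sqrt k%:R * Num.sqrt (X %/ k)%:R <= Num.sqrt X%:R :> R.
    by rewrite -sqM ler_sqrt // ler_nat mulnC leq_trunc_div.
  have -> : k%:R^-1 = (Num.sqrt k%:R)^-1 * (Num.sqrt k%:R)^-1 :> R.
    by rewrite -invfM -expr2 sqr_sqrtr.
  have -> : 2 * Num.sqrt X%:R * ((Num.sqrt k%:R)^-1 * (Num.sqrt k%:R)^-1) =
    (Num.sqrt k%:R)^-1 * (2 * (Num.sqrt X%:R / Num.sqrt k%:R)) :> R by ring.
  rewrite ler_wpM2l ?invr_ge0 // ler_wpM2l //.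
  by rewrite ler_pdivlMr ?lt0r ?sqn0 ?sq0 // mulrC.
rewrite -big_distrr /=.
have -> : \sum_(1 <= k < X.+1) k%:R^-1 * g k = \sum_(1 <= k < X.+1)
    \sum_(1 <= f < k.+1 | (f %| k)%N)
      ((f%:R * Num.sqrt f%:R)^-1 * (k %/ f)%:R^-1) :> R.
  apply: eq_bigr => k _; rewrite /g big_distrr /=; apply: eq_bigr => f fk.
  by rewrite -{1}(divnK fk) natrM !invfM; ring.
rewrite (sum_divisor_pairs _ _ (fun f j => (f%:R * Num.sqrt f%:R)^-1 * j%:R^-1)).
have -> : 6 * Num.sqrt X%:R * harmonic_sum R X =
  2 * Num.sqrt X%:R * (3 * harmonic_sum R X) by ring.
rewrite ler_wpM2l ?mulr_ge0 //.
apply: (@le_trans _ _ (\sum_(1 <= f < X.+1)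
    (f%:R * Num.sqrt f%:R)^-1 * harmonic_sum R X)).
  apply: ler_sum_nat => f _; rewrite -big_distrr /=.
  rewrite ler_wpM2l ?invr_ge0 ?mulr_ge0 //.
  by apply/le_harmonic_sum/leq_div.
by rewrite -big_distrl /= ler_wpM2r ?harmonic_sum_ge0 ?sum_inv_mul_sqrt_le.
Qed.

(** * The bilinear sawtooth sum for exponent one *)

Lemma weight1E (R : pzRingType) (X d : nat) :
  weight R 1 X d = d%:R * mertens R (X %/ d).
Proof. by rewrite /weight expn1. Qed.

(** The lcm is [d * (e %/ gcdn d e)]; Moebius inversion in the gcd frees [e] to run over the
    multiples [k * a] of [k]. Opening [mertens] and exchanging the sums over [a] and [m] leaves
    complete sums over [a]. *)
Lemma sum_weight_sawtooth (R : numFieldType) (X Y d : nat) : (0 < d)%N ->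
  \sum_(1 <= e < X.+1) weight R 1 X e * sawtooth R Y (lcmn d e) =
  \sum_(1 <= k < X.+1 | (k %| d)%N) \sum_(1 <= f < k.+1 | (f %| k)%N)
    (mobius f)%:~R * k%:R * \sum_(1 <= m < (X %/ k).+1)
      (mobius m)%:~R * sawtooth_sum R Y (d * f) (X %/ k %/ m).
Proof.
move=> d0; pose h e g := sawtooth R Y (d * (e %/ g)).
pose I k e : R := \sum_(1 <= f < k.+1 | (f %| k)%N) (mobius f)%:~R * h e (k %/ f)%N.
transitivity (\sum_(1 <= e < X.+1) \sum_(1 <= k < X.+1)
   if (k %| d)%N then if (k %| e)%N then weight R 1 X e * I k e else 0 else 0).
  apply: eq_big_nat => e /andP[e0 eX].
  have g0 : (0 < gcdn d e)%N by rewrite gcdn_gt0 d0.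
  have gX : (gcdn d e <= X)%N.
    by rewrite (leq_trans (dvdn_leq e0 (dvdn_gcdr d e))).
  have -> : lcmn d e = (d * (e %/ gcdn d e))%N.
    by rewrite /lcmn -muln_divA // dvdn_gcdr.
  rewrite -/(h e (gcdn d e)) -(@mobius_inversion _ (h e) _ g0).
  rewrite (@sum_divisors_widen _ _ X) ?g0 // big_distrr big_mkcond /=.
  by apply: eq_bigr => k _; rewrite dvdn_gcd; case: (k %| d)%N.
rewrite exchange_big [RHS]big_mkcond; apply: eq_big_nat => k /andP[k0 kX] /=.
case: ifP => kd; last by rewrite big1.
rewrite -big_mkcond sum_multiples //=.
transitivity (\sum_(1 <= a < (X %/ k).+1) \sum_(1 <= f < k.+1 | (f %| k)%N)
   (mobius f)%:~R * k%:R * (a%:R * mertens R (X %/ k %/ a)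
      * sawtooth R Y (d * f * a))).
  apply: eq_bigr => a _; rewrite /I big_distrr weight1E /=.
  apply: eq_bigr => f fk; have f0 : (0 < f)%N := dvdn_gt0 k0 fk.
  have kf0 : (0 < k %/ f)%N by rewrite divn_gt0 // dvdn_leq.
  (* Here [k %/ f] stands in for the gcd, so that the quotient of [e = k * a] is [f * a]. *)
  have E : (d * (k * a %/ (k %/ f)) = d * f * a)%N.
    by rewrite -{1}(divnK fk) -mulnA mulKn // mulnA.
  by rewrite /h E natrM divnMA; ring.
rewrite exchange_big; apply: eq_bigr => f _ /=.
rewrite -big_distrr /=; congr (_ * _).
pose F a m : R := (mobius m)%:~R * (a%:R * sawtooth R Y (d * f * a)).
transitivity (\sum_(1 <= a < (X %/ k).+1)
    \sum_(1 <= m < (X %/ k %/ a).+1) F a m).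
  apply: eq_bigr => a _; rewrite /F -big_distrl /= -/(mertens R _); ring.
rewrite exchange_hyperbola; apply: eq_bigr => m _.
by rewrite -big_distrr.
Qed.

(** Insert [norm_sawtooth_sum_le] with length at most [X / (k * m)] and argument [Y / (d * f)]. Over
    [m] the cubic part converges, with sum at most [2], and the other part gives a harmonic sum. *)
Lemma norm_sum_sawtooth_sum_le (R : rcfType) (X Y d k f : nat) :
  (0 < d <= X)%N -> (0 < Y)%N -> (0 < k)%N -> (0 < f)%N ->
  `|k%:R * \sum_(1 <= m < (X %/ k).+1)
      (mobius m)%:~R * sawtooth_sum R Y (d * f) (X %/ k %/ m)| <=
  20 * X%:R ^+ 4 / Y%:R * (f%:R / k%:R ^+ 2) +
  3 * X%:R * Num.sqrt Y%:R * (1 + harmonic_sum R Y) * harmonic_sum R X *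
    (Num.sqrt d%:R * Num.sqrt f%:R)^-1.
Proof.
move=> /andP[d0 dX] Y0 k0 f0.
have Yp : (0 : R) < Y%:R by rewrite ltr0n.
have kp : (0 : R) < k%:R by rewrite ltr0n.
have dp : (0 : R) < d%:R by rewrite ltr0n.
have fp : (0 : R) < f%:R by rewrite ltr0n.
have dX' : (d%:R : R) <= X%:R by rewrite ler_nat.
have X0 : (0 : R) <= X%:R by [].
have L0 : 0 <= 1 + harmonic_sum R Y by rewrite addr_ge0 ?harmonic_sum_ge0.
set q : R := (Num.sqrt d%:R * Num.sqrt f%:R)^-1.
have q0 : 0 <= q by rewrite invr_ge0 mulr_ge0 ?sqrtr_ge0.
have sY0 : 0 <= Num.sqrt (Y%:R : R) by apply: sqrtr_ge0.
set L := 1 + harmonic_sum R Y in L0 *.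
set c1 : R := 10 * X%:R ^+ 4 / Y%:R * (f%:R / k%:R ^+ 3).
set c2 : R := 3 * X%:R * Num.sqrt Y%:R * L * q / k%:R.
have c10 : 0 <= c1 by rewrite !mulr_ge0 ?invr_ge0 ?exprn_ge0.
have c20 : 0 <= c2 by rewrite !mulr_ge0 ?invr_ge0.
have term m : (0 < m)%N ->
    `|(mobius m)%:~R * sawtooth_sum R Y (d * f) (X %/ k %/ m)| <=
    c1 * (m%:R ^+ 3)^-1 + c2 * m%:R^-1.
  move=> m0; have mp : (0 : R) < m%:R by rewrite ltr0n.
  rewrite normrM; apply: (@le_trans _ _ (1 * (c1 * (m%:R ^+ 3)^-1 + c2 * m%:R^-1))).
    2: by rewrite mul1r.
  apply: ler_pM => //; first exact: norm_mobius_le1.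
  have df0 : (0 < d * f)%N by rewrite muln_gt0 d0.
  apply: le_trans (norm_sawtooth_sum_le R Y _ (X %/ k %/ m) df0 Y0) _.
  have A1 : (X %/ k %/ m)%:R <= X%:R / (k%:R * m%:R) :> R.
    rewrite -divnMA ler_pdivlMr ?mulr_gt0 // -!natrM ler_nat.
    exact: leq_trunc_div.
  have A0 : (0 : R) <= (X %/ k %/ m)%:R by [].
  move: A1 A0; move: ((X %/ k %/ m)%:R : R) => A A1 A0.
  apply: lerD.
    have -> : 10 * (A ^+ 3 / (Y%:R / (d * f)%:R)) =
        10 / Y%:R * (A ^+ 3 * (d%:R * f%:R)).
      by rewrite natrM; field; rewrite !gt_eqF.
    have -> : c1 / m%:R ^+ 3 =
        10 / Y%:R * ((X%:R / (k%:R * m%:R)) ^+ 3 * (X%:R * f%:R)).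
      by rewrite /c1; field; rewrite !gt_eqF.
    rewrite ler_wpM2l ?divr_ge0 //.
    apply: ler_pM; rewrite ?exprn_ge0 ?mulr_ge0 //.
      by rewrite lerXn2r ?nnegrE // (le_trans A0).
    by rewrite ler_wpM2r.
  have -> : Num.sqrt (Y%:R / (d * f)%:R) = Num.sqrt Y%:R * q :> R.
    by rewrite natrM sqrtrM // sqrtrV ?mulr_ge0 // sqrtrM.
  have -> : c2 / m%:R = X%:R / (k%:R * m%:R) * (3 * (Num.sqrt Y%:R * q) * L).
    by rewrite /c2; field; rewrite !gt_eqF.
  have -> : 3 * A * (Num.sqrt Y%:R * q) * L = A * (3 * (Num.sqrt Y%:R * q) * L).
    by ring.
  by rewrite ler_wpM2r // !mulr_ge0.
rewrite normrM normr_nat.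
apply: (@le_trans _ _ (k%:R * (c1 * 2 + c2 * harmonic_sum R X))); last first.
  rewrite le_eqVlt; apply/orP; left; apply/eqP.
  by rewrite /c1 /c2; field; rewrite !gt_eqF.
rewrite ler_wpM2l //; apply: le_trans (ler_norm_sum _ _ _) _.
apply: (@le_trans _ _ (\sum_(1 <= m < (X %/ k).+1)
    (c1 * (m%:R ^+ 3)^-1 + c2 * m%:R^-1))).
  by apply: ler_sum_nat => m /andP[m0 _]; apply: term.
rewrite big_split -!big_distrr /=; apply: lerD; rewrite ler_wpM2l //.
  by have := sum_inv_exp_tail R 2 0 (X %/ k).+1 isT; rewrite expr1n divr1.
by apply/le_harmonic_sum/leq_div.
Qed.

(** The outer weight is at most [X], and the two chain sums contribute the factors [4] and [6]. *)
Lemma sum_weight2_sawtooth_le (R : rcfType) (X Y : nat) : (0 < Y)%N ->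
  `|\sum_(1 <= d < X.+1) \sum_(1 <= e < X.+1)
      weight R 1 X d * weight R 1 X e * sawtooth R Y (lcmn d e)| <=
  80 * (X%:R ^+ 6 / Y%:R) + 18 * (X%:R ^+ 2 * Num.sqrt X%:R * Num.sqrt Y%:R *
    (1 + harmonic_sum R Y) * harmonic_sum R X ^+ 2).
Proof.
move=> Y0; have HX := harmonic_sum_ge0 R X.
have L0 : 0 <= 1 + harmonic_sum R Y by rewrite addr_ge0 ?harmonic_sum_ge0.
set L := 1 + _ in L0 *; set H := harmonic_sum R X in HX *.
have sX0 : 0 <= Num.sqrt (X%:R : R) by apply: sqrtr_ge0.
have sY0 : 0 <= Num.sqrt (Y%:R : R) by apply: sqrtr_ge0.
pose c1 : R := 20 * X%:R ^+ 4 / Y%:R.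
pose c2 : R := 3 * X%:R * Num.sqrt Y%:R * L * H.
have c10 : 0 <= c1 by rewrite !mulr_ge0 ?invr_ge0 ?exprn_ge0.
have c20 : 0 <= c2 by rewrite !mulr_ge0 ?invr_ge0.
apply: (@le_trans _ _ (\sum_(1 <= d < X.+1) X%:R *
    \sum_(1 <= k < d.+1 | (k %| d)%N) \sum_(1 <= f < k.+1 | (f %| k)%N)
      (c1 * (f%:R / k%:R ^+ 2) + c2 * (Num.sqrt d%:R * Num.sqrt f%:R)^-1))).
  apply: le_trans (ler_norm_sum _ _ _) _.
  apply: ler_sum_nat => d /andP[d0 dX]; rewrite ltnS in dX.
  under eq_bigr => e _ do rewrite -mulrA.
  rewrite -big_distrr normrM /=; apply: ler_pM => //.
    by have := norm_weight_le R 1 X d isT dX.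
  rewrite sum_weight_sawtooth // -(@sum_divisors_widen _ d X) ?d0 //.
  apply: le_trans (ler_norm_sum _ _ _) _.
  apply: ler_sum => k kd; have k0 := dvdn_gt0 d0 kd.
  apply: le_trans (ler_norm_sum _ _ _) _.
  apply: ler_sum => f fk; have f0 := dvdn_gt0 k0 fk.
  rewrite -mulrA normrM.
  have := norm_sum_sawtooth_sum_le R X Y d k f; rewrite d0 dX => /(_ isT Y0 k0 f0).
  apply: le_trans; rewrite ler_piMl //; exact: norm_mobius_le1.
rewrite -big_distrr /=.
have -> : \sum_(1 <= d < X.+1) \sum_(1 <= k < d.+1 | (k %| d)%N)
    \sum_(1 <= f < k.+1 | (f %| k)%N)
      (c1 * (f%:R / k%:R ^+ 2) + c2 * (Num.sqrt d%:R * Num.sqrt f%:R)^-1) =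
  c1 * (\sum_(1 <= d < X.+1) \sum_(1 <= k < d.+1 | (k %| d)%N)
    \sum_(1 <= f < k.+1 | (f %| k)%N) (f%:R / k%:R ^+ 2)) +
  c2 * (\sum_(1 <= d < X.+1) \sum_(1 <= k < d.+1 | (k %| d)%N)
    \sum_(1 <= f < k.+1 | (f %| k)%N) (Num.sqrt d%:R * Num.sqrt f%:R)^-1).
  rewrite !big_distrr -big_split /=; apply: eq_bigr => d _.
  rewrite !big_distrr -big_split /=; apply: eq_bigr => k _.
  by rewrite !big_distrr -big_split.
have h1 := ler_wpM2l c10 (sum_divisor_chain_cube R X).
have h2 := ler_wpM2l c20 (sum_divisor_chain_sqrt R X).
apply: le_trans (ler_wpM2l (ler0n _ _) (lerD h1 h2)) _.
rewrite le_eqVlt; apply/orP; left; apply/eqP; rewrite /c1 /c2 -/H; field.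
by rewrite gt_eqF // ltr0n.
Qed.

(** The constant [1 / 2] in [sawtooth] produces [P ^+ 2 / 2], because the weights themselves sum to
    [P]. *)
Lemma C2_real_1_jordan (R : realType) (x y : R) : 1 <= y ->
  let P := \sum_(1 <= k < (Num.truncn x).+1) jordan R 1 k in
  `|C2_real R 1 x y - ((Num.truncn y)%:R * P - P ^+ 2 / 2)| <=
  let X : R := (Num.truncn x)%:R in let Y : R := (Num.truncn y)%:R in
  80 * (X ^+ 6 / Y) + 18 * (X ^+ 2 * Num.sqrt X * Num.sqrt Y *
    (1 + harmonic_sum R (Num.truncn y)) * harmonic_sum R (Num.truncn x) ^+ 2).
Proof.
rewrite -truncn_gt0 /C2_real /=; set X := Num.truncn x; set Y := Num.truncn y.
move=> Y0; have := sum_weight2_sawtooth_le R X Y Y0.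
rewrite -normrN; congr (`|_| <= _).
rewrite -{1}sum_weight_lcm -sum_weight expr2 big_distrr /=.
rewrite [X in _ - (_ - X / 2)]big_distrl mulr_suml -sumrB -sumrB /= -sumrN.
apply: eq_big_nat => d /andP[d0 _].
rewrite !big_distrr mulr_suml -sumrB -sumrB -sumrN /=.
apply: eq_big_nat => e /andP[e0 _].
by rewrite /sawtooth !expn1; ring.
Qed.

(** * Fitting the bounds to the stated error terms *)

(** At each point the whole of [f] goes to one error function: to [E1] if [g1] alone bounds it with
    constant [2 * K], otherwise to [E2], as [g2] then must. *)
Lemma bigO_large_split (R : realType) (D : R -> R -> Prop) (f g1 g2 : R -> R -> R)
    (K x0 : R) : 0 <= K ->
  (forall x y, x0 <= x -> D x y -> `|f x y| <= K * (`|g1 x y| + `|g2 x y|)) ->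
  exists E1 E2, [/\ bigO_large D E1 g1, bigO_large D E2 g2 &
    forall x y, f x y = E1 x y + E2 x y].
Proof.
move=> K0 fK; pose c x y := `|f x y| <= 2 * K * `|g1 x y|.
exists (fun x y => if c x y then f x y else 0).
exists (fun x y => if c x y then 0 else f x y); split.
- exists (2 * K), x0 => x y _ _; rewrite /c; case: ifP => // _.
  by rewrite normr0 !mulr_ge0.
- exists (2 * K), x0 => x y xx Dxy; rewrite /c; case: ifPn => [_|].
    by rewrite normr0 !mulr_ge0.
  by rewrite -ltNge => h; have := fK x y xx Dxy; lra.
- by move=> x y; case: ifP; rewrite ?addr0 ?add0r.
Qed.

(** Constants: [160] doubles [80] since [y <= 2 * Num.truncn y]; [21] is [20] from squaring [P] plus
    [1] from rounding [y]; [23] is [18] plus the [5] from the error of [P]. *)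
Lemma C2_real_1_asymp (R : realType) (x y : R) : 1 <= x -> x ^+ 2 <= y ->
  `|C2_real R 1 x y - (y * x ^+ 2 / (2 * zeta 2)
     - 1 / 2 * (x ^+ 4 / (2 ^+ 2 * zeta 2 ^+ 2)))| <=
  160 * (y^-1 * x ^+ 6) + 21 * (x ^+ 3 * (1 + ln x)) +
  23 * (y * (x * Num.sqrt x) * ((2 + ln y) * (1 + ln x) ^+ 2)).
Proof.
move=> x1 xy; have x0 : 0 < x by lra.
have xx2 : x <= x ^+ 2 by rewrite expr2 ler_peMr // ltW.
have y1 : 1 <= y by lra.
have y0 : 0 < y by lra.
have ly := ln_ge0 y1; have lx := ln_ge0 x1.
have lx' : 1 + ln x <= x.
  have : ln (1 + (x - 1)) <= x - 1 by apply: le_ln1Dx; lra.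
  by rewrite [1 + (x - 1)]addrC subrK; lra.
have := C2_real_1_jordan R x y y1.
have := sum_jordan_asymp R 1 x isT x1.
have Z1 := zeta_ge1 R 1 isT.
have -> : (1 + 1%:R : R) = 2 by [].
have E2 : (1 + 1%:R : R) = 2 by [].
rewrite E2 in Z1; set Z := zeta 2 in Z1 *.
set P := \sum_(1 <= k < _) _; rewrite expr1 => hP hC.
have /andP[Xx _] := truncn_itv (ltW x0).
have /andP[Yy yY] := truncn_itv (ltW y0).
have Y0 : (0 < Num.truncn y)%N by rewrite truncn_gt0.
have HX := harmonic_sum_truncn R x x1.
have HY := harmonic_sum_truncn R y y1.
have HX0 := harmonic_sum_ge0 R (Num.truncn x).
have HY0 := harmonic_sum_ge0 R (Num.truncn y).
have Y1 : (1 : R) <= (Num.truncn y)%:R by rewrite ler1n.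
have X0 : (0 : R) <= (Num.truncn x)%:R by [].
rewrite -natr1 in yY.
move: hC Xx Yy yY HX HY HX0 HY0 Y1 X0 => /=.
move: (harmonic_sum R _) (harmonic_sum R _) => HXn HYn.
move: ((Num.truncn x)%:R) ((Num.truncn y)%:R) => X Y.
move=> hC Xx Yy yY HX HY HX0 HY0 Y1 X0.
set l := 1 + ln x in lx' hP HX *.
have l1 : 1 <= l by rewrite /l; lra.
have Y0' : 0 < Y by lra.
set s := Num.sqrt x; have s0 : 0 <= s by apply: sqrtr_ge0.
have s1 : 1 <= s by rewrite -sqrtr1 ler_sqrt //; lra.
have B1 : X ^+ 6 / Y <= 2 * (y^-1 * x ^+ 6).
  have -> : 2 * (y^-1 * x ^+ 6) = x ^+ 6 * (2 / y) 
    by field; rewrite gt_eqF.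
  apply: ler_pM; rewrite ?exprn_ge0 ?invr_ge0 ?(ltW Y0') //.
    by rewrite lerXn2r ?nnegrE // ltW.
  by rewrite ler_pdivlMr // mulrC ler_pdivrMr //; lra.
have B2 : X ^+ 2 * Num.sqrt X * Num.sqrt Y * (1 + HYn) * HXn ^+ 2 <=
    y * (x * s) * ((2 + ln y) * l ^+ 2).
  rewrite -mulrA; apply: ler_pM; rewrite ?mulr_ge0 ?exprn_ge0 ?sqrtr_ge0 //.
  - lra.
  - apply: (@le_trans _ _ (x ^+ 2 * s * Num.sqrt y)).
      apply: ler_pM; rewrite ?mulr_ge0 ?exprn_ge0 ?sqrtr_ge0 //.
        apply: ler_pM; rewrite ?mulr_ge0 ?exprn_ge0 ?sqrtr_ge0 //.
          by rewrite lerXn2r ?nnegrE // ltW.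
        by rewrite ler_sqrt // ltW.
      by rewrite ler_sqrt // ltW.
    (* The assumption [x ^+ 2 <= y] enters here, turning [x * sqrt y] into [y]. *)
    have xq : x <= Num.sqrt y.
      by rewrite -[leLHS]ger0_norm ?(ltW x0) // -sqrtr_sqr ler_sqrt // ltW.
    have qy : Num.sqrt y * Num.sqrt y = y by rewrite -expr2 sqr_sqrtr // ltW.
    have -> : x ^+ 2 * s * Num.sqrt y = x * s * (x * Num.sqrt y) by ring.
    rewrite [leRHS]mulrC ler_wpM2l ?mulr_ge0 ?(ltW x0) // -[leRHS]qy.
    by rewrite ler_wpM2r ?sqrtr_ge0.
  - apply: ler_pM; rewrite ?exprn_ge0 //; first by lra.
      by lra.
    by rewrite lerXn2r ?nnegrE //; lra.
pose c := (2 * Z)^-1.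
have c0 : 0 < c by rewrite invr_gt0; lra.
have c1 : c <= 1 by rewrite invf_le1; lra.
have E1 : y * x ^+ 2 / (2 * Z) = y * (c * x ^+ 2) by rewrite /c; ring.
have E4 : 1 / 2 * (x ^+ 4 / (2 ^+ 2 * Z ^+ 2)) = (c * x ^+ 2) ^+ 2 / 2.
  by rewrite /c; field; lra.
rewrite E1 E4; have hP' : `|P - c * x ^+ 2| <= 5 * (x * l).
  have -> : c * x ^+ 2 = x ^+ 2 / (2 * Z) by rewrite mulrC.
  by apply: le_trans hP _; rewrite expr1; lra.
have xl : x * l <= x ^+ 2 by rewrite expr2 ler_wpM2l // ltW.
have xl0 : 0 <= x * l by rewrite mulr_ge0; lra.
have cx0 : 0 <= c * x ^+ 2 by rewrite mulr_ge0 ?exprn_ge0 ?ltW.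
have cx : c * x ^+ 2 <= x ^+ 2 by rewrite ler_piMl // exprn_ge0 // ltW.
have A1 : `|Y * P - y * (c * x ^+ 2)| <= 5 * (y * (x * l)) + x ^+ 2.
  have -> : Y * P - y * (c * x ^+ 2) = Y * (P - c * x ^+ 2) + (Y - y) * (c * x ^+ 2).
    by ring.
  apply: le_trans (ler_normD _ _) _; apply: lerD; rewrite normrM.
    rewrite [leRHS]mulrCA; apply: ler_pM => //.
    by rewrite gtr0_norm.
  rewrite -[leRHS]mul1r; apply: ler_pM => //.
    by rewrite ler_norml; apply/andP; split; lra.
  by rewrite ger0_norm.
have A2 : `|P ^+ 2 / 2 - (c * x ^+ 2) ^+ 2 / 2| <= 20 * (x ^+ 3 * l).
  have -> : P ^+ 2 / 2 - (c * x ^+ 2) ^+ 2 / 2 =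
     (P - c * x ^+ 2) * ((P - c * x ^+ 2 + 2 * (c * x ^+ 2)) / 2).
    by ring.
  have -> : 20 * (x ^+ 3 * l) = 5 * (x * l) * (4 * x ^+ 2) by ring.
  rewrite normrM; apply: ler_pM => //.
  move: hP'; rewrite !ler_norml => /andP[p1 p2]; apply/andP; split; lra.
have x2l : x ^+ 2 <= x ^+ 3 * l.
  rewrite -[leLHS]mulr1; apply: ler_pM; rewrite ?exprn_ge0 ?(ltW x0) //.
  by rewrite [leRHS]exprS ler_peMl ?exprn_ge0 // ltW.
have A3 : y * (x * l) <= y * (x * s) * ((2 + ln y) * l ^+ 2).
  rewrite mulrA; apply: ler_pM; rewrite ?mulr_ge0 ?(ltW x0) ?(ltW y0) //.
  - by lra.
  - by rewrite ler_wpM2l ?(ltW y0) // ler_peMr // ltW.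
  - rewrite expr2 mulrA -[leLHS]mul1r ler_wpM2r //; first by lra.
    by rewrite mulr_ege1 //; lra.
have T1 := ler_normD (C2_real R 1 x y - (Y * P - P ^+ 2 / 2))
  (Y * P - y * (c * x ^+ 2) - (P ^+ 2 / 2 - (c * x ^+ 2) ^+ 2 / 2)).
have T2 := ler_normB (Y * P - y * (c * x ^+ 2)) (P ^+ 2 / 2 - (c * x ^+ 2) ^+ 2 / 2).
have -> : C2_real R 1 x y - (y * (c * x ^+ 2) - (c * x ^+ 2) ^+ 2 / 2) =
  C2_real R 1 x y - (Y * P - P ^+ 2 / 2) +
  (Y * P - y * (c * x ^+ 2) - (P ^+ 2 / 2 - (c * x ^+ 2) ^+ 2 / 2)) by ring.
lra.
Qed.

Lemma ln_ln_ge0 (R : realType) (x : R) : expR 1 <= x -> 1 <= ln x /\ 0 <= ln (ln x).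
Proof.
move=> xe; have x0 : 0 < x by apply: lt_le_trans xe; apply: expR_gt0.
have l1 : 1 <= ln x by rewrite -[leLHS]expRK ler_ln // posrE expR_gt0.
by split=> //; apply: ln_ge0.
Qed.

(** The extra [x ^+ (2 * b + 2)] on the left makes room for the second main term when [b = 2]; with
    the one from [C2_real_asymp] it accounts for the final [2] in the constant. *)
Lemma C2_real_crude (R : realType) (b : nat) (x y : R) : (0 < b)%N ->
  expR 1 <= x -> x <= y -> x ^+ (2 * b + 2) <= y * x `^ (1 / 2 + b%:R) ->
  `|C2_real R b x y - y * x ^+ (1 + b) / ((1 + b%:R) * zeta (1 + b%:R))| +
    x ^+ (2 * b + 2) <=
  (2 * (2 ^+ b + 4) + 2) *
    (y * x `^ (1 / 2 + b%:R) * (ln x ^+ 3 + ln (ln x) ^+ 3)).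
Proof.
move=> b0 xe xy xb; have [l1 ll0] := ln_ln_ge0 R x xe.
have x1 : 1 <= x by apply: le_trans xe; have := expR_ge1Dx (1 : R); lra.
have y0 : 0 <= y by lra.
have := C2_real_asymp R b x y b0 x1 xy.
set M := `|_ - _|; set p := x `^ _ in xb *.
have bp : x ^+ b <= p.
  by rewrite -powR_mulrn; [apply: ler_powR | ]; lra.
have p0 : 0 <= p by apply: powR_ge0.
have l3 : ln x <= ln x ^+ 3 by rewrite ler_eXnr.
have L3 : 1 <= ln x ^+ 3 + ln (ln x) ^+ 3.
  by have := exprn_ge0 3 ll0; lra.
have yp0 : 0 <= y * p by rewrite mulr_ge0.
have h1 : y * x ^+ b * (1 + ln x) <= 2 * (y * p * (ln x ^+ 3 + ln (ln x) ^+ 3)).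
  have -> : 2 * (y * p * (ln x ^+ 3 + ln (ln x) ^+ 3)) =
    y * p * (2 * (ln x ^+ 3 + ln (ln x) ^+ 3)) by ring.
  apply: ler_pM; rewrite ?mulr_ge0 ?exprn_ge0 ?ler_wpM2l //; try lra.
  by have := exprn_ge0 3 ll0; lra.
have h2 : x ^+ (2 * b + 2) <= y * p * (ln x ^+ 3 + ln (ln x) ^+ 3).
  by apply: (le_trans xb); rewrite ler_peMr.
have k0 : 0 <= 2 ^+ b + 4 :> R by rewrite addr_ge0 ?exprn_ge0.
have h3 := ler_wpM2l k0 h1.
move=> h; lra.
Qed.

(** As [ln x <= x], the upper limit for [y] is at most [x ^+ 8]. *)
Lemma ln_le_mul_ln (R : realType) (x y : R) : 1 <= x -> 0 < y ->
  y < x ^+ 3 * ln x ^+ 5 -> ln y <= 8 * ln x.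
Proof.
move=> x1 y0 yx; have x0 : 0 < x by lra.
have -> : 8 * ln x = ln (x ^+ 8) by rewrite lnXn // mulr_natl.
rewrite ler_ln ?posrE ?exprn_gt0 //; apply: ltW; apply: (lt_le_trans yx).
rewrite (exprD x 3 5) ler_wpM2l ?exprn_ge0 ?(ltW x0) //.
by rewrite lerXn2r ?nnegrE ?ln_ge0 ?(ltW x0) // ltW // ln_sublinear.
Qed.

(** The constant is [23 * 40]: from [ln y <= 8 * ln x] and [1 <= ln x], the logarithms are at most
    [10 * ln x * (2 * ln x) ^ 2]. *)
Lemma C2_real_1_bound (R : realType) (x y : R) : expR 1 <= x ->
  x ^+ 2 < y -> y < x ^+ 3 * ln x ^+ 5 ->
  `|C2_real R 1 x y - (y * x ^+ 2 / (2 * zeta 2)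
     - 1 / 2 * (x ^+ 4 / (2 ^+ 2 * zeta 2 ^+ 2)))| <=
  920 * ((y^-1 * x ^+ 6 + x ^+ 3 * ln x) +
    y * x `^ (1 / 2 + 1) * (ln x ^+ 3 + ln (ln x) ^+ 3)).
Proof.
move=> xe xy yx; have [l1 ll0] := ln_ln_ge0 R x xe.
have x1 : 1 <= x by apply: le_trans xe; have := expR_ge1Dx (1 : R); lra.
have x0 : 0 < x by lra.
have y0 : 0 < y by apply: lt_trans xy; rewrite exprn_gt0.
have ly := ln_le_mul_ln R x y x1 y0 yx.
have y1 : 1 <= y by apply: ltW; apply: le_lt_trans xy; rewrite exprn_ege1.
have := C2_real_1_asymp R x y x1 (ltW xy).
have -> : x * Num.sqrt x = x `^ (1 / 2 + 1).
  rewrite powRD; last by rewrite gt_eqF ?implybT.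
  by rewrite powRr1 ?(ltW x0) // div1r powR12_sqrt ?(ltW x0) // mulrC.
have p0 : 0 <= x `^ (1 / 2 + 1) by apply: powR_ge0.
have x3 : 0 <= x ^+ 3 by rewrite exprn_ge0 // ltW.
have yi : 0 <= y^-1 * x ^+ 6.
  by rewrite mulr_ge0 ?invr_ge0 ?exprn_ge0 // ltW.
have ly0 := ln_ge0 y1.
move: `|_ - _| (x `^ _) (ln y) p0 ly ly0 => M p v p0 ly ly0.
move: (y^-1 * _) yi => g yi.
have yp0 : 0 <= y * p by rewrite mulr_ge0 // ltW.
move: (x ^+ 3) (y * p) x3 yp0 => x3 yp x30 yp0.
move: (ln x) (ln (ln x)) l1 ll0 ly => l ll l1 ll0 ly h.
have ll3 := exprn_ge0 3 ll0.
have xl3 : x3 * (1 + l) <= 2 * (x3 * l) by rewrite mulrCA ler_wpM2l //; lra.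
have k3 : (2 + v) * (1 + l) ^+ 2 <= 40 * (l ^+ 3 + ll ^+ 3).
  apply: (@le_trans _ _ ((10 * l) * (2 * l) ^+ 2)).
    apply: ler_pM; rewrite ?exprn_ge0 //; try lra.
    by rewrite lerXn2r ?nnegrE //; lra.
  have -> : 10 * l * (2 * l) ^+ 2 = 40 * l ^+ 3 by ring.
  by lra.
have yk := ler_wpM2l yp0 k3.
have xl0 : 0 <= x3 * l by rewrite mulr_ge0 //; lra.
apply: (le_trans h); lra.
Qed.

(** From [x ^+ 4 < y] one gets [x ^+ 6 <= y * x ^+ 2], so both the dropped fractional parts and the
    second main term fit into the error. *)
Lemma C2_real_2_bound (R : realType) (x y : R) : expR 1 <= x -> x ^+ 4 < y ->
  `|C2_real R 2 x y - (y * x ^+ 3 / ((1 + 2%:R) * zeta (1 + 2%:R))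
     - 1 / 2 * (x ^+ 6 / ((1 + 2%:R) ^+ 2 * zeta (1 + 2%:R) ^+ 2)))| <=
  (2 * (2 ^+ 2 + 4) + 2) *
    (y * x `^ (1 / 2 + 2%:R) * (ln x ^+ 3 + ln (ln x) ^+ 3)).
Proof.
move=> xe xy; have x1 : 1 <= x.
  by apply: le_trans xe; have := expR_ge1Dx (1 : R); lra.
have x0 : 0 <= x by lra.
have xy' : x <= y by apply: ltW; apply: le_lt_trans xy; rewrite ler_eXnr.
have p2 : x ^+ 6 <= y * x `^ (1 / 2 + 2%:R).
  rewrite (exprD x 4 2); apply: ler_pM; rewrite ?exprn_ge0 ?(ltW xy) //.
  by rewrite -powR_mulrn //; apply: ler_powR => //; lra.
apply: le_trans (C2_real_crude R 2 x y isT xe xy' p2).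
have Z1 := zeta_ge1 R 2 isT; move: (zeta _) Z1 => Z Z1.
rewrite opprB addrA addrAC; apply: le_trans (ler_normD _ _) _.
rewrite lerD2l.
have d1 : 1 <= (1 + 2%:R) ^+ 2 * Z ^+ 2.
  by rewrite mulr_ege1 ?exprn_ege1 //; lra.
have x6 : 0 <= x ^+ 6 by rewrite exprn_ge0.
have d2 : 0 <= x ^+ 6 / ((1 + 2%:R) ^+ 2 * Z ^+ 2) by rewrite divr_ge0 //; lra.
have d3 : x ^+ 6 / ((1 + 2%:R) ^+ 2 * Z ^+ 2) <= x ^+ 6.
  by rewrite ler_pdivrMr ?ler_peMr //; lra.
rewrite ger0_norm; last by rewrite mulr_ge0 // divr_ge0.
change (x ^+ (2 * 2 + 2)) with (x ^+ 6).
by apply: le_trans d3; rewrite ler_piMl //; lra.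
Qed.

Theorem theorem1p3 (R : realType) :
  (forall beta : nat, (beta = 1%N \/ beta = 2%N) ->
    let b : R := beta%:R in
    let D := fun x y : R =>
      x ^+ (2 * beta) < y /\
      y < x ^+ (2 * beta + beta ^ 2) * (ln x) `^ (5 / 2 * (b + 1)) in
    exists E1 E2 : R -> R -> R,
      [/\ bigO_large D E1 (fun x y =>
            y^-1 * x ^+ (2 + 4 * beta) +
            x ^+ (2 * beta + 1) * (ln x + ln (ln x))),
          bigO_large D E2 (fun x y =>
            x ^+ (2 * beta) * y `^ (1 / 3 + 1 / (6 * b)) *
              (ln y) ^+ 5 * ln (ln y) * ((ln x) ^+ 4 + (ln (ln x)) ^+ 4) +
            y * x `^ (1 / 2 + b) * ((ln x) ^+ 3 + (ln (ln x)) ^+ 3)) &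
          forall x y : R, D x y ->
            C2 beta x y =
              (y * x ^+ (1 + beta) / ((1 + b) * zeta (1 + b))
               - 1 / 2 * (x ^+ (2 + 2 * beta) /
                          ((1 + b) ^+ 2 * zeta (1 + b) ^+ 2))
               + E1 x y + E2 x y)%:C])
  /\
  (forall beta : nat, (3 <= beta)%N ->
    let b : R := beta%:R in
    let D := fun x y : R => x `^ (3 * b / 2) < y in
    exists E1 E2 : R -> R -> R,
      [/\ bigO_large D E1 (fun x y =>
            x ^+ (2 * beta) * y `^ (1 / 3 + 1 / (6 * b)) *
              (ln y) ^+ 5 * ln (ln y) * ((ln x) ^+ 4 + (ln (ln x)) ^+ 4)),
          bigO_large D E2 (fun x y =>
            y * x `^ (1 / 2 + b) * ((ln x) ^+ 3 + (ln (ln x)) ^+ 3)) &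
          forall x y : R, D x y ->
            C2 beta x y =
              (y * x ^+ (1 + beta) / ((1 + b) * zeta (1 + b))
               + E1 x y + E2 x y)%:C]).
Proof.
have e1 : 1 <= expR 1 :> R by have := expR_ge1Dx (1 : R); lra.
split=> [beta hb b D|beta beta3 b D].
  have beta0 : (0 < beta)%N by case: hb => ->.
  pose f x y := C2_real R beta x y - (y * x ^+ (1 + beta) / ((1 + b) * zeta (1 + b))
     - 1 / 2 * (x ^+ (2 + 2 * beta) / ((1 + b) ^+ 2 * zeta (1 + b) ^+ 2))).
  set g1 := fun x y : R => y^-1 * _ + _; set g2 := fun x y : R => _ + y * _ * _.
  (* For [expR 1 <= x <= y] all iterated logarithms are nonnegative, so dropping a summand of [g2]
     only decreases it. *)
  have pos x y : expR 1 <= x -> x <= y ->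
      y * x `^ (1 / 2 + b) * ((ln x) ^+ 3 + (ln (ln x)) ^+ 3) <= `|g2 x y|.
    move=> xe xy; have [l1 ll0] := ln_ln_ge0 R x xe.
    have [l1' ll0'] := ln_ln_ge0 R y (le_trans xe xy).
    have x0 : 0 <= x by lra.
    apply: le_trans (ler_norm _); rewrite /g2 lerDr.
    by rewrite !mulr_ge0 ?addr_ge0 ?exprn_ge0 ?powR_ge0 //; lra.
  have pos1 x y : expR 1 <= x -> x <= y ->
      y^-1 * x ^+ (2 + 4 * beta) + x ^+ (2 * beta + 1) * ln x <= `|g1 x y|.
    move=> xe xy; have [l1 ll0] := ln_ln_ge0 R x xe.
    have x0 : 0 <= x by lra.
    apply: le_trans (ler_norm _); rewrite /g1 lerD2l ler_wpM2l ?exprn_ge0 //.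
    by rewrite lerDl.
  (* One bound by the sum of both error terms is enough; [bigO_large_split] then supplies [E1] and
     [E2]. *)
  suff [K K0 hK] : exists2 K : R, 0 <= K & forall x y, expR 1 <= x -> D x y ->
      `|f x y| <= K * (`|g1 x y| + `|g2 x y|).
    case: (@bigO_large_split R D f g1 g2 K _ K0 hK) => E1 [E2 [hE1 hE2 fE]].
    exists E1, E2; split=> // x y _.
    by rewrite C2E // -addrA -fE /f addrC subrK.
  have Dxy x y : expR 1 <= x -> D x y -> x <= y.
    move=> xe [xy _]; apply: ltW; apply: le_lt_trans xy.
    by rewrite ler_eXnr ?muln_gt0 //; lra.
  case: hb => bE.
    exists 920; first exact: ler0n.
    move=> x y xe Dx; have xy := Dxy x y xe Dx.
    have := lerD (pos1 x y xe xy) (pos x y xe xy).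
    move: (`|g1 x y| + `|g2 x y|) => G; case: Dx => Dx1.
    rewrite /f /b bE => Dx2 hG.
    apply: le_trans (ler_wpM2l (ler0n _ _) hG).
    apply: C2_real_1_bound => //; first by move: Dx1; rewrite bE.
    move: Dx2; have -> : 5 / 2 * (1%:R + 1) = 5%:R :> R by lra.
    by rewrite powR_mulrn // ln_ge0 // (le_trans e1).
  exists (2 * (2 ^+ 2 + 4) + 2); first by rewrite addr_ge0 ?mulr_ge0.
  move=> x y xe Dx; have xy := Dxy x y xe Dx.
  apply: (@le_trans _ _ ((2 * (2 ^+ 2 + 4) + 2) * `|g2 x y|)); last first.
    by rewrite ler_wpM2l ?lerDr // addr_ge0 ?mulr_ge0.
  have := pos x y xe xy; move: (`|g2 x y|) => G; case: Dx => Dx1 _.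
  rewrite /f /b bE => hG.
  have K0 : 0 <= 2 * (2 ^+ 2 + 4) + 2 :> R by rewrite addr_ge0 ?mulr_ge0.
  apply: le_trans (ler_wpM2l K0 hG).
  by apply: C2_real_2_bound => //; move: Dx1; rewrite bE.
have beta0 : (0 < beta)%N by lia.
have b3 : 3 <= b by rewrite /b ler_nat.
pose f x y := C2_real R beta x y - y * x ^+ (1 + beta) / ((1 + b) * zeta (1 + b)).
set g1 := fun x y : R => _ * _ * _ * _ * _; set g2 := fun x y : R => y * _ * _.
pose K : R := 2 * (2 ^+ beta + 4) + 2.
have K0 : 0 <= K by rewrite addr_ge0 ?mulr_ge0 ?addr_ge0 ?exprn_ge0.
have hK x y : expR 1 <= x -> D x y -> `|f x y| <= K * (`|g1 x y| + `|g2 x y|).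
  move=> xe Dx; have x1 : 1 <= x by lra.
  have xy : x <= y.
    apply: ltW; apply: le_lt_trans Dx; rewrite -[leLHS]powRr1; last by lra.
    by apply: ler_powR => //; lra.
  (* Here [3 <= beta] is decisive: [3 * b / 2 + 1 / 2 + b] is at least [2 * b + 2] exactly when
     [3 <= b]. *)
  have p2 : x ^+ (2 * beta + 2) <= y * x `^ (1 / 2 + b).
    apply: (@le_trans _ _ (x `^ (3 * b / 2) * x `^ (1 / 2 + b))).
      rewrite -powRD; last by apply/implyP; lra.
      rewrite -powR_mulrn; last by lra.
      by apply: ler_powR => //; rewrite natrD natrM -/b; lra.
    by rewrite ler_wpM2r ?powR_ge0 // ltW.
  have := C2_real_crude R beta x y beta0 xe xy p2; rewrite -/b -/K => h.
  have x0 : 0 <= x ^+ (2 * beta + 2) by rewrite exprn_ge0 //; lra.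
  have h2 : `|f x y| <= K * g2 x y by rewrite /f /g2; lra.
  apply: (le_trans h2); rewrite ler_wpM2l //.
  by apply: le_trans (ler_norm _) _; rewrite lerDr.
case: (@bigO_large_split R D f g1 g2 K _ K0 hK) => E1 [E2 [hE1 hE2 fE]].
exists E1, E2; split=> // x y _.
by rewrite C2E // -addrA -fE /f addrC subrK.
Qed.
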